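(* Let $G$ be a finite group, let $p$ be a prime, and let $P$ be a Sylow $p$-subgroup of $G$. If the nilpotency class of $P$ does not exceed $p$, then the Bogomolov multipliers of $G$ and of $N_G(P)$ have isomorphic Sylow $p$-subgroups.
   Context: For a finite group $K$, regard $\mathbb{Q}/\mathbb{Z}$ as a trivial $K$-module. The Bogomolov multiplier of $K$ is the subgroup $\mathrm{Sha}^2(K,\mathbb{Q}/\mathbb{Z})$ of $H^2(K,\mathbb{Q}/\mathbb{Z})$ defined as $$\mathrm{Sha}^2(K,\mathbb{Q}/\mathbb{Z})=\bigcap_{A\le K,\ A\text{ abelian}}\ker\left(\mathrm{res}^K_A: H^2(K,\mathbb{Q}/\mathbb{Z})\to H^2(A,\mathbb{Q}/\mathbb{Z})\right),$$ where $\mathrm{res}^K_A$ is the restriction map. $N_G(P)$ denotes the normalizer of $P$ in $G$. *)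

(* Defs.v *)
From HB Require Import structures.
From mathcomp Require Import all_boot all_order all_fingroup all_solvable.
From mathcomp Require Import all_algebra.
From mathcomp Require Import boolp.

Set Implicit Arguments.
Unset Strict Implicit.
Unset Printing Implicit Defensive.

Import Order.TTheory GRing.Theory Num.Theory.

Local Open Scope ring_scope.
Local Open Scope quotient_scope.

Definition rat_int : {pred rat} := fun q => q \is a Num.int.

Fact rat_int_zmod_closed : zmod_closed rat_int.
Proof. by split=> [|x y xZ yZ]; [exact: Num.Theory.int_num0 | exact: rpredB]. Qed.

HB.instance Definition _ :=
  GRing.isZmodClosed.Build rat rat_int rat_int_zmod_closed.

Notation QmodZ := {ideal_quot rat_int}.

Lemma QmodZ_divisible n (q : QmodZ) : (0 < n)%N -> exists r, r *+ n == q.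
Proof.
move=> n_gt0; elim/quotW: q => q; exists (\pi_QmodZ (q / n%:R)); apply/eqP.
rewrite -raddfMn /= -[_ *+ n]mulr_natr divfK //.
by rewrite pnatr_eq0 -lt0n.
Qed.

Lemma QmodZ_torsion n (q : QmodZ) :
  (0 < n)%N -> q *+ n = 0 -> exists i : 'I_n, \pi_QmodZ (i%:R / n%:R) == q.
Proof.
move=> n_gt0; have n0 : n%:R != 0 :> rat by rewrite pnatr_eq0 -lt0n.
elim/quotW: q => r; rewrite -raddfMn -(raddf0 \pi_QmodZ) => /eqP.
rewrite -Quotient.idealrBE subr0 => /Num.Theory.intrP[m rE].
have nz0 : n%:Z != 0 by rewrite eqz_nat -lt0n.
have m_lt : (`|(m %% n%:Z)%Z| < n)%N.
  by rewrite -ltz_nat gez0_abs ?modz_ge0 ?ltz_pmod.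
exists (Ordinal m_lt); rewrite -Quotient.idealrBE; apply/Num.Theory.intrP.
exists (- (m %/ n%:Z)%Z).
rewrite /= natr_absz ger0_norm ?modz_ge0 //.
have -> : r = m%:~R / n%:R by rewrite -rE -[r *+ n]mulr_natr mulfK.
rewrite -mulrBl -intrB {2}(divz_eq m n%:Z) opprD addrCA subrr addr0.
by rewrite -mulNr intrM mulfK.
Qed.

Lemma subrACA (V : zmodType) (a b c d : V) : a - b - (c - d) = a - c - (b - d).
Proof. by rewrite opprD addrACA -opprD. Qed.

Lemma diff_cancel (V : zmodType) (a b d e g h : V) :
  a - b + d - (a - e + g) + (b - e + h) - (d - g + h) = 0.
Proof.
have -> : a - b + d - (a - e + g) = d - g - (b - e).
  rewrite [- (_ + g)]opprD addrACA [a - b - _]subrACA.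
  by rewrite subrr sub0r addrC.
by rewrite addrA subrK subrr.
Qed.

(* Inhomogeneous cochains of the whole group gT; the cohomology of a subgroup K
   is that of the type subg_of K. *)
Section Cohomology.

Variable gT : finGroupType.

Definition cochain1 := {ffun gT -> QmodZ}.
Definition cochain2 := {ffun gT * gT -> QmodZ}.
Definition cochain3 := {ffun gT * gT * gT -> QmodZ}.

HB.instance Definition _ := GRing.Zmodule.on cochain1.
HB.instance Definition _ := GRing.Zmodule.on cochain2.
HB.instance Definition _ := GRing.Zmodule.on cochain3.

(* The action on Q/Z is trivial, so no action appears in the differentials. *)
Definition diff1 (c : cochain1) : cochain2 :=
  [ffun x => c x.2 - c (x.1 * x.2)%g + c x.1].

Definition diff2 (f : cochain2) : cochain3 :=
  [ffun x => f (x.1.2, x.2) - f ((x.1.1 * x.1.2)%g, x.2)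
             + f (x.1.1, (x.1.2 * x.2)%g) - f (x.1.1, x.1.2)].

Fact diff1_is_zmod_morphism : zmod_morphism diff1.
Proof. by move=> c d; apply/ffunP=> x; rewrite !ffunE subrACA addrACA -opprD. Qed.

Fact diff2_is_zmod_morphism : zmod_morphism diff2.
Proof.
move=> f g; apply/ffunP=> x; rewrite !ffunE.
by rewrite subrACA addrACA -opprD subrACA.
Qed.

HB.instance Definition _ :=
  GRing.isZmodMorphism.Build cochain1 cochain2 diff1 diff1_is_zmod_morphism.
HB.instance Definition _ :=
  GRing.isZmodMorphism.Build cochain2 cochain3 diff2 diff2_is_zmod_morphism.

Lemma diff2_diff1 c : diff2 (diff1 c) = 0.
Proof.
apply/ffunP=> -[[x y] z]; rewrite !ffunE /= mulgA; exact: diff_cancel.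
Qed.

Definition is_cocycle2 : {pred cochain2} := fun f => diff2 f == 0.

Fact is_cocycle2_zmod_closed : zmod_closed is_cocycle2.
Proof.
split=> [|f g /eqP f0 /eqP g0]; first by rewrite unfold_in raddf0.
by rewrite unfold_in raddfB /= f0 g0 subr0.
Qed.

HB.instance Definition _ :=
  GRing.isZmodClosed.Build cochain2 is_cocycle2 is_cocycle2_zmod_closed.

Record cocycle2 :=
  Cocycle2 {cocycle2_val :> cochain2; _ : cocycle2_val \in is_cocycle2}.

HB.instance Definition _ := [isSub for cocycle2_val].
HB.instance Definition _ := [Choice of cocycle2 by <:].
HB.instance Definition _ := [SubChoice_isSubZmodule of cocycle2 by <:].

Definition is_coboundary2 : {pred cocycle2} :=
  fun f => `[< exists c : cochain1, val f = diff1 c >].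

Fact is_coboundary2_zmod_closed : zmod_closed is_coboundary2.
Proof.
split=> [|f g /asboolP[c fE] /asboolP[d gE]]; apply/asboolP.
  by exists 0; rewrite !raddf0.
by exists (c - d); rewrite raddfB /= fE gE raddfB.
Qed.

HB.instance Definition _ :=
  GRing.isZmodClosed.Build cocycle2 is_coboundary2 is_coboundary2_zmod_closed.

Definition H2 := {ideal_quot is_coboundary2}.

HB.instance Definition _ := Choice.on H2.
HB.instance Definition _ := GRing.Zmodule.on H2.
HB.instance Definition _ := Quotient.on H2.

Lemma pi_H2_is_zmod_morphism : zmod_morphism (\pi_H2 : cocycle2 -> H2).
Proof. exact: (raddfB (\pi_({ideal_quot is_coboundary2}))). Qed.

HB.instance Definition _ := GRing.isZmodMorphism.Build cocycle2 H2
  (\pi_H2 : cocycle2 -> H2) pi_H2_is_zmod_morphism.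

Lemma eq_pi_H2 (f g : cocycle2) :
  (\pi_H2 f = \pi_H2 g) <-> exists c, val f - val g = diff1 c.
Proof.
split=> [/eqP|[c fgE]]; last apply/eqP.
  by rewrite -Quotient.idealrBE => /asboolP[c]; rewrite raddfB; exists c.
by rewrite -Quotient.idealrBE; apply/asboolP; exists c; rewrite raddfB.
Qed.

Lemma cocycle2_torsion (f : cocycle2) :
  val f *+ #|gT| = diff1 [ffun x => \sum_z val f (x, z)].
Proof.
apply/ffunP=> -[x y].
have fE z : val f (x, y) =
    val f (y, z) - val f ((x * y)%g, z) + val f (x, (y * z)%g).
  have /eqP/ffunP/(_ (x, y, z)) := valP f; rewrite !ffunE /= => /eqP.
  by rewrite subr_eq0 => /eqP->.
rewrite ffunMnE -sumr_const (eq_bigr _ (fun z _ => fE z)) !ffunE /=.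
rewrite !(big_split, sumrN) /=; congr (_ + _).
by rewrite [RHS](reindex_inj (mulgI y)).
Qed.

Definition H2_of_grid (t : {ffun gT * gT -> 'I_#|gT|}) : H2 :=
  \pi_H2 (insubd (0 : cocycle2) [ffun x => \pi_QmodZ ((t x)%:R / #|gT|%:R)]).

(* Every class has a representative killed by #|gT|, i.e. with values in
   (1/#|gT|)Z / Z; this makes H2 finite, so that the Sylow theory of finite
   groups applies to it. *)
Lemma H2_of_grid_surj (x : H2) : exists t, H2_of_grid t == x.
Proof.
have G0 : (0 < #|gT|)%N by apply/card_gt0P; exists 1%g.
elim/quotW: x => f.
pose div q := xchoose (QmodZ_divisible q G0).
have divK q : div q *+ #|gT| = q by apply/eqP/(xchooseP (QmodZ_divisible q G0)).
pose c : cochain1 := [ffun x => div (\sum_z val f (x, z))].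
have dc_cocycle : diff1 c \in is_cocycle2 by rewrite unfold_in diff2_diff1.
pose g : cocycle2 := f - Cocycle2 dc_cocycle.
have gE : val g = val f - diff1 c by rewrite raddfB.
have g_tors : val g *+ #|gT| = 0.
  rewrite gE mulrnBl cocycle2_torsion -raddfMn -raddfB /=.
  rewrite [X in diff1 X](_ : _ = 0) ?raddf0 //.
  by apply/ffunP=> x; rewrite !(ffunE, ffunMnE) divK subrr.
have gx_tors x : val g x *+ #|gT| = 0 by rewrite -ffunMnE g_tors ffunE.
exists [ffun x => xchoose (QmodZ_torsion G0 (gx_tors x))].
apply/eqP; rewrite /H2_of_grid.
set h := [ffun x => _].
have -> : h = val g.
  apply/ffunP=> x; rewrite !ffunE.
  exact/eqP/(xchooseP (QmodZ_torsion G0 (gx_tors x))).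
rewrite valKd; apply/eq_pi_H2; exists (- c).
by rewrite gE raddfN addrC addKr.
Qed.

Definition grid_of_H2 (x : H2) := xchoose (H2_of_grid_surj x).

Fact grid_of_H2K : cancel grid_of_H2 H2_of_grid.
Proof. by move=> x; apply/eqP/(xchooseP (H2_of_grid_surj x)). Qed.

HB.instance Definition _ : isCountable H2 := CanIsCountable grid_of_H2K.
HB.instance Definition _ : isFinite H2 := CanIsFinite grid_of_H2K.

(* The multiplicative notation of finite groups on H2 denotes its addition. *)
HB.instance Definition _ := [finGroupMixin of H2 for +%R].

End Cohomology.

Section Restriction.

Variables (gT : finGroupType) (A : {group gT}).

Definition res_cochain2 (f : cochain2 gT) : cochain2 (subg_of A) :=
  [ffun x => f (sgval x.1, sgval x.2)].

Fact res_is_cocycle2 (f : cocycle2 gT) :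
  res_cochain2 (val f) \in @is_cocycle2 (subg_of A).
Proof.
rewrite unfold_in; apply/eqP/ffunP=> -[[x y] z].
have /eqP/ffunP/(_ (sgval x, sgval y, sgval z)) := valP f.
by rewrite !ffunE /= => ->.
Qed.

Definition res_cocycle2 (f : cocycle2 gT) : cocycle2 (subg_of A) :=
  Cocycle2 (res_is_cocycle2 f).

Definition res_H2 (x : H2 gT) : H2 (subg_of A) :=
  \pi_(H2 (subg_of A)) (res_cocycle2 (generic_quotient.repr x)).

Lemma res_H2_pi (f : cocycle2 gT) :
  res_H2 (\pi_(H2 gT) f) = \pi_(H2 (subg_of A)) (res_cocycle2 f).
Proof.
have /eq_pi_H2[c cE] : \pi_(H2 gT) (generic_quotient.repr (\pi_(H2 gT) f)) =
    \pi_(H2 gT) f by rewrite reprK.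
apply/eq_pi_H2; exists [ffun x => c (sgval x)]; apply/ffunP=> -[x y].
by have /ffunP/(_ (sgval x, sgval y)) := cE; rewrite !ffunE.
Qed.

Fact res_H2_morph : {in [set: H2 gT] &, {morph res_H2 : x y / (x * y)%g}}.
Proof.
move=> x y _ _; elim/quotW: x => f; elim/quotW: y => g.
rewrite !FinRing.zmodMgE -raddfD !res_H2_pi -raddfD; congr (\pi _).
by apply/val_inj/ffunP=> x; rewrite !ffunE.
Qed.

Canonical res_H2_morphism := Morphism res_H2_morph.

End Restriction.

Definition Sha2 (gT : finGroupType) : {group H2 gT} :=
  (\bigcap_(A : {group gT} | abelian A) 'ker (res_H2 A))%G.

Lemma Sha2P (gT : finGroupType) (x : H2 gT) :
  reflect (forall A : {group gT}, abelian A -> res_H2 A x = 0) (x \in Sha2 gT).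
Proof.
apply: (iffP bigcapP) => [xS A /xS /mker // | xS A abA].
by rewrite !inE; apply/eqP/xS.
Qed.

Definition bogomolov_multiplier (gT : finGroupType) (K : {group gT}) :
  {group H2 (subg_of K)} := Sha2 (subg_of K).

(* Main.v *)
From HB Require Import structures.
Require Import Defs.
From mathcomp Require Import all_boot all_order all_fingroup all_solvable.
From mathcomp Require Import all_algebra.
From mathcomp Require Import boolp.

Set Implicit Arguments.
Unset Strict Implicit.
Unset Printing Implicit Defensive.

Import GRing.Theory Num.Theory.

Local Open Scope group_scope.

(** Restriction embeds the [p]-part of the Bogomolov multiplier of [G] into the
group of classes of [P] that vanish on the abelian subgroups of [P] and are
invariant under [N_G(P)]: it is injective since restriction followed by
corestriction multiplies by the index of [P] ([cor_res], [cobound_sylow]). This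
target depends on [G] only through [N_G(P)], and [P] is also a Sylow subgroup of
its normaliser, so it is enough to show that the embedding is onto
([sylow_bogomolov_isog]).

Let [phi] be the composite of corestriction from [P] to [G] and restriction
back to [P], as an endomorphism of the finite [p]-group of invariant classes.
If [phi] is injective it is onto, and so is restriction. By Mackey's formula
[phi] is the multiplication by [#|N_G(P) : P|], which is prime to [p], plus a
sum of corestrictions from proper subgroups [D] of [P], where [D] is the
intersection of [P] with a conjugate of [P]. A class [a] of order [p] with
[phi a = 0] is therefore a combination of such corestrictions of conjugates of
[a] itself, and this can be iterated.

At each step [a] is a sum of corestrictions [cor_E^P b] from subgroups [E] of
bounded order. The restriction to [D] of a conjugate of [cor_E^P b] is a sum
over double cosets of corestrictions from intersections of [D] with conjugates
of [E]. If no conjugate of [E] is contained in [D] these are smaller than [E].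
Otherwise [D] and [E] lie in a common maximal subgroup [M], and the restriction
of [cor_E^P b] to [M] is the norm, that is the sum of the [P / M]-conjugates, of
the class [cor_E^M b]. Once norms are known to vanish, the order of [E] goes
down at each step, hence [a = 0] ([sum_from_small_descent], [cobound_of_cor]).

The vanishing of norms is the only place where the class of [P] matters
([gext_der_sum]). Let [b] be a class of [M] of exponent [p] that vanishes on
abelian subgroups. By Shapiro's lemma it corresponds to an extension [X] of [P]
by the functions from [P / M] to [F_p], and commuting elements of [M] have
commuting lifts. Let [N] be the preimage of [M] in [X]. Bracketing [N^`(1)] with
[X] repeatedly leads to commutators of elements of [N] that lie in the [i]-th
and [j]-th terms of the lower central series of [X] with larger and larger
[i + j]. When [i + j] exceeds the class of [P] the images of such elements
commute, hence so do the elements. So [p - 1] commutators with [X] kill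
[N^`(1)], by [commg_sub_ucn]. For a function [v] on [P / M] that lies in
[N^`(1)] this says that the [p - 1]-st iterated difference of [v] along a
generator of [P / M] is zero, but in characteristic [p] this difference is the
sum of the values of [v]. So the sum of values is a character of the kernel that
is trivial on commutators; it extends to [N] because [Q/Z] is divisible, which
means that the norm of [b] is zero ([cobound_sum_small_class]).

Cochains are functions on the whole ambient group that are constrained on a
subgroup only, which makes restriction the identity. Classes of several
subgroups are handled at once as cocycles on the action groupoid of a finite set
with an action. Such a cocycle is a coboundary as soon as it is one on each
stabiliser ([gcobound_stab]), and corestriction is then a plain sum over the
points of the set. *)

(** * Linear identities in abelian groups *)

(** Integral combinations of atoms: an identity between sums and differences in
an abelian group holds when the coefficients of each atom agree. *)
Inductive zexpr :=
  ZVar of nat | ZZero | ZAdd of zexpr & zexpr | ZOpp of zexpr.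

Section ZExpr.
Local Open Scope ring_scope.

Fixpoint zcoef (e : zexpr) (i : nat) : int :=
  match e with
  | ZVar j => (i == j)%:R
  | ZZero => 0
  | ZAdd e1 e2 => zcoef e1 i + zcoef e2 i
  | ZOpp e1 => - zcoef e1 i
  end.

Variable V : zmodType.

Fixpoint zeval (env : seq V) (e : zexpr) : V :=
  match e with
  | ZVar j => nth 0 env j
  | ZZero => 0
  | ZAdd e1 e2 => zeval env e1 + zeval env e2
  | ZOpp e1 => - zeval env e1
  end.

Lemma zevalE env e : zeval env e = \sum_(i < size env) nth 0 env i *~ zcoef e i.
Proof.
elim: e => [j||e1 IH1 e2 IH2|e IH] /=.
- case: (ltnP j (size env)) => jlt.
    rewrite (bigD1 (Ordinal jlt)) //= eqxx mulr1z big1 ?addr0 // => i ij.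
    by rewrite (negPf (_ : nat_of_ord i != j)) ?mulr0z.
  rewrite nth_default // big1 // => i _.
  by rewrite (ltn_eqF (leq_trans (ltn_ord i) jlt)) mulr0z.
- by rewrite big1 // => i _; rewrite mulr0z.
- by rewrite IH1 IH2 -big_split; apply: eq_bigr => i _; rewrite mulrzDr.
- by rewrite IH -sumrN; apply: eq_bigr => i _; rewrite mulrNz.
Qed.

Lemma zeval_eq env e1 e2 :
    all (fun i => zcoef e1 i == zcoef e2 i) (iota 0 (size env)) ->
  zeval env e1 = zeval env e2.
Proof.
move=> /allP e12; rewrite !zevalE; apply: eq_bigr => i _.
by rewrite (eqP (e12 i _)) // mem_iota ltn_ord.
Qed.

End ZExpr.

(** Atoms are compared up to unification, since the same group product may be
reached through several paths of the hierarchy of structures. *)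
Ltac zmod_index x env :=
  lazymatch env with
  | ?y :: ?s =>
      match goal with
      | _ => let _ := match goal with _ => unify x y end in constr:(0%N)
      | _ => let n := zmod_index x s in constr:(S n)
      end
  end.

Ltac zmod_atoms env e :=
  lazymatch e with
  | @GRing.add _ ?a ?b =>
      let env1 := zmod_atoms env a in zmod_atoms env1 b
  | @GRing.opp _ ?a => zmod_atoms env a
  | @GRing.zero _ => env
  | _ => match env with
         | _ => let _ := zmod_index e env in env
         | _ => constr:(e :: env)
         end
  end.

Ltac zmod_reify env e :=
  lazymatch e with
  | @GRing.add _ ?a ?b =>
      let a1 := zmod_reify env a in
      let b1 := zmod_reify env b in constr:(ZAdd a1 b1)
  | @GRing.opp _ ?a => let a1 := zmod_reify env a in constr:(ZOpp a1)
  | @GRing.zero _ => constr:(ZZero)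
  | _ => let n := zmod_index e env in constr:(ZVar n)
  end.

Ltac zmodule :=
  lazymatch goal with
  | |- @eq ?T ?a ?b =>
      let env0 := zmod_atoms (@nil T) a in
      let env := zmod_atoms env0 b in
      let ea := zmod_reify env a in
      let eb := zmod_reify env b in
      exact: (@zeval_eq _ env ea eb isT)
  end.

(** * Cochains on subgroups and on finite sets with an action *)

Section Cochains.

Variables (gT : finGroupType) (V : zmodType).
Implicit Types (A K L : {group gT}) (f g : gT -> gT -> V).

Definition cocyc (K : {set gT}) f :=
  forall x y z, x \in K -> y \in K -> z \in K ->
  (f y z - f (x * y)%g z + f x (y * z)%g - f x y = 0)%R.

Definition cobound (K : {set gT}) f :=
  exists c : gT -> V,
  forall x y, x \in K -> y \in K -> (f x y = c y - c (x * y)%g + c x)%R.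

Definition gact (Om : Type) (K : {set gT}) (act : Om -> gT -> Om) :=
  (forall w, act w 1 = w) /\
  (forall w x y, x \in K -> y \in K -> act w (x * y) = act (act w x) y).

Definition gstab (Om : eqType) (K : {set gT}) (act : Om -> gT -> Om) w :=
  [set x in K | act w x == w].

(** A 2-cocycle on the action groupoid, whose arrows are [x : w -> act w x]; on
a one-point set this is [cocyc]. When [K] is transitive on [Om] the class of [F]
amounts, by Shapiro's lemma, to the class of [F w] on the stabiliser of [w]. *)
Definition gcocyc (Om : Type) (K : {set gT}) (act : Om -> gT -> Om)
    (F : Om -> gT -> gT -> V) :=
  forall w x y z, x \in K -> y \in K -> z \in K ->
  (F (act w x) y z - F w (x * y)%g z + F w x (y * z)%g - F w x y = 0)%R.

Definition gcobound (Om : Type) (K : {set gT}) (act : Om -> gT -> Om)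
    (F : Om -> gT -> gT -> V) :=
  exists c : Om -> gT -> V,
  forall w x y, x \in K -> y \in K ->
  (F w x y = c (act w x) y - c w (x * y)%g + c w x)%R.

Lemma coboundS (K L : {set gT}) f : L \subset K -> cobound K f -> cobound L f.
Proof.
by move=> /subsetP sLK [c cE]; exists c => x y Lx Ly; apply: cE; apply: sLK.
Qed.

Lemma eq_cobound (K : {set gT}) f g :
    (forall x y, x \in K -> y \in K -> f x y = g x y) ->
  cobound K f -> cobound K g.
Proof. by move=> fg [c cE]; exists c => x y Kx Ky; rewrite -fg // cE. Qed.

Lemma cobound0 (K : {set gT}) : cobound K (fun _ _ => 0%R).
Proof. by exists (fun=> 0%R) => x y _ _; rewrite subrr addr0. Qed.

Lemma coboundD (K : {set gT}) f g :
  cobound K f -> cobound K g -> cobound K (fun x y => f x y + g x y)%R.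
Proof.
move=> [c fE] [d gE]; exists (fun x => c x + d x)%R => x y Kx Ky.
rewrite fE // gE //; zmodule.
Qed.

Lemma coboundN (K : {set gT}) f :
  cobound K f -> cobound K (fun x y => - f x y)%R.
Proof.
move=> [c fE]; exists (fun x => - c x)%R => x y Kx Ky.
rewrite fE //; zmodule.
Qed.

Lemma coboundB (K : {set gT}) f g :
  cobound K f -> cobound K g -> cobound K (fun x y => f x y - g x y)%R.
Proof. by move=> cf cg; apply: coboundD => //; apply: coboundN. Qed.

Lemma coboundMn (K : {set gT}) f n :
  cobound K f -> cobound K (fun x y => f x y *+ n)%R.
Proof.
move=> [c fE]; exists (fun x => c x *+ n)%R => x y Kx Ky.
by rewrite fE // mulrnDl mulrnBl.
Qed.

Lemma cobound_sum (I : finType) (Q : pred I) (K : {set gT})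
    (f : I -> gT -> gT -> V) :
    (forall i, Q i -> cobound K (f i)) ->
  cobound K (fun x y => \sum_(i | Q i) f i x y)%R.
Proof.
move=> cf.
have /choice[c cE] i : exists c : gT -> V, Q i ->
    forall x y, x \in K -> y \in K -> (f i x y = c y - c (x * y)%g + c x)%R.
  case Qi: (Q i); last by exists (fun=> 0%R).
  by have [c cE] := cf i Qi; exists c.
exists (fun x => \sum_(i | Q i) c i x)%R => x y Kx Ky.
rewrite -sumrB -big_split /=; apply: eq_bigr => i Qi; exact: cE.
Qed.

Lemma cocycS (K L : {set gT}) f : L \subset K -> cocyc K f -> cocyc L f.
Proof.
by move=> /subsetP sLK fK x y z Lx Ly Lz; apply: fK; apply: sLK.
Qed.

Lemma cocyc_gcocyc (K : {set gT}) f :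
  cocyc K f <-> gcocyc K (fun w _ => w) (fun _ : unit => f).
Proof. by split=> [cf w|cf]; [apply: cf | apply: (cf tt)]. Qed.

Lemma group_set_gstab (Om : eqType) K (act : Om -> gT -> Om) w :
  gact K act -> group_set (gstab K act w).
Proof.
case=> act1 actM; apply/group_setP; split=> [|x y].
  by rewrite inE group1 act1 eqxx.
rewrite !inE => /andP[Kx /eqP wx] /andP[Ky /eqP wy].
by rewrite groupM // actM // wx wy eqxx.
Qed.

Lemma gactK (Om : Type) K (act : Om -> gT -> Om) x :
  gact K act -> x \in K -> cancel (act^~ x) (act^~ x^-1).
Proof. by case=> act1 actM Kx w; rewrite -actM ?groupV // mulgV. Qed.

Lemma gactKV (Om : Type) K (act : Om -> gT -> Om) x :
  gact K act -> x \in K -> cancel (act^~ x^-1) (act^~ x).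
Proof. by case=> act1 actM Kx w; rewrite -actM ?groupV // mulVg. Qed.

Lemma gact_inj (Om : Type) K (act : Om -> gT -> Om) x :
  gact K act -> x \in K -> injective (act^~ x).
Proof. by move=> aK Kx; apply: can_inj (gactK aK Kx). Qed.

Lemma gactS (Om : Type) (K L : {set gT}) (act : Om -> gT -> Om) :
  L \subset K -> gact K act -> gact L act.
Proof.
by move=> /subsetP sLK [a1 aM]; split=> // w x y Lx Ly; apply: aM; apply: sLK.
Qed.

Lemma gcocycS (Om : Type) (K L : {set gT}) (act : Om -> gT -> Om) F :
  L \subset K -> gcocyc K act F -> gcocyc L act F.
Proof.
by move=> /subsetP sLK cF w x y z Lx Ly Lz; apply: cF; apply: sLK.
Qed.

Lemma orbit_transversal_choice (Om : finType) K (act : Om -> gT -> Om) :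
    gact K act ->
  exists rt : Om -> Om * gT,
    [/\ forall w, (rt w).2 \in K,
        forall w, act (rt w).1 (rt w).2 = w
      & forall w x, x \in K -> (rt (act w x)).1 = (rt w).1].
Proof.
move=> aK; have [act1 actM] := aK.
pose conn w v := [exists x in K, act v x == w].
have connP w v : reflect (exists2 x, x \in K & act v x = w) (conn w v).
  by apply: (iffP exists_inP) => -[x Kx /eqP]; exists x => //; apply/eqP.
pose r w := odflt w [pick v | conn w v].
have rP w : conn w (r w).
  rewrite /r; case: pickP => //= _.
  by apply/connP; exists 1.
have rE w x : x \in K -> r (act w x) = r w.
  move=> Kx.
  have E v : conn (act w x) v = conn w v.
    apply/connP/connP => -[y Ky yE].
      exists (y * x^-1); rewrite ?groupM ?groupV // actM ?groupV // yE.
      by rewrite (gactK aK).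
    by exists (y * x); rewrite ?groupM // actM // yE.
  rewrite /r (eq_pick E); case: pickP => //= no.
  by have := rP w; rewrite no.
pose t w := odflt 1 [pick x in K | act (r w) x == w].
have tP w : t w \in K /\ act (r w) (t w) = w.
  rewrite /t; case: pickP => [x /andP[Kx /eqP] //|no].
  by have /connP[x Kx /eqP xE] := rP w; have := no x; rewrite /= Kx xE.
by exists (fun w => (r w, t w)); split=> [w|w|w x /rE] //=; case: (tP w).
Qed.

(** The shape in which three instances of a cocycle identity combine when a
cocycle is pulled back along two functors related by a natural
transformation. *)
Lemma eq_lin3 (a b x y z : V) :
  (x = 0 -> y = 0 -> z = 0 -> a = b + x - y + z -> a = b)%R.
Proof. by move=> -> -> ->; rewrite oppr0 !addr0. Qed.

(** Injectivity in Shapiro's lemma: the action groupoid retracts onto the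
stabilisers of orbit representatives, and the retraction is naturally isomorphic
to the identity. *)
Lemma gcobound_stab (Om : finType) K (act : Om -> gT -> Om) F :
    gact K act -> gcocyc K act F ->
    (forall w, cobound (gstab K act w) (F w)) ->
  gcobound K act F.
Proof.
move=> aK cF /choice[b bE]; have [act1 actM] := aK.
have [rt [Kt tE rE]] := orbit_transversal_choice aK.
pose r w := (rt w).1; pose t w := (rt w).2.
(* [h] is the retraction and [t] the natural isomorphism. *)
pose h w x := t w * x * (t (act w x))^-1.
have Kh w x : x \in K -> h w x \in K by move=> Kx; rewrite !groupM ?groupV ?Kt.
have htE w x : h w x * t (act w x) = t w * x by rewrite mulgKV.
have rh w x : x \in K -> act (r w) (h w x) = r w.
  move=> Kx; apply: (gact_inj aK (Kt (act w x))).
  rewrite -actM ?Kh ?Kt // htE actM ?Kt // tE.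
  by rewrite -[r w](rE w x Kx) tE.
have hS w x : x \in K -> h w x \in gstab K act (r w).
  by move=> Kx; rewrite inE Kh //= rh.
have hM w x y : x \in K -> y \in K -> h w (x * y) = h w x * h (act w x) y.
  by move=> Kx Ky; rewrite /h actM // !mulgA mulgKV.
exists (fun w x => b (r w) (h w x) +
  (F (r w) (t w) x - F (r w) (h w x) (t (act w x))))%R.
move=> w x y Kx Ky.
have rxE : r (act w x) = r w by apply: rE.
have hS2 : h (act w x) y \in gstab K act (r w) by rewrite -rxE hS.
have := cF (r w) (h w x) (h (act w x) y) (t (act (act w x) y))
  (Kh w x Kx) (Kh _ _ Ky) (Kt _).
rewrite rh // [F _ _ (h (act w x) y)]bE ?hS // -hM // => Z0.
have := cF (r w) (h w x) (t (act w x)) y (Kh w x Kx) (Kt _) Ky.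
rewrite rh // -[(t (act w x) * y)%g]htE => Y0.
have := cF (r w) (t w) x y (Kt w) Kx Ky.
rewrite tE -htE => X0.
rewrite rxE actM //.
apply: (eq_lin3 X0 Y0 Z0); zmodule.
Qed.

End Cochains.

Section Transport.

Variables (gT : finGroupType) (V : zmodType).
Implicit Types (K P : {group gT}) (f : gT -> gT -> V).

Section Pushforward.

Variables (Om Om' : finType) (K : {group gT}).
Variables (act : Om -> gT -> Om) (act' : Om' -> gT -> Om').
Variables (Q : pred Om) (pi : Om -> Om').
Hypothesis aK : gact K act.
Hypothesis aK' : gact K act'.
Hypothesis QE : forall w z, z \in K -> Q (act w z) = Q w.
Hypothesis piE : forall w z, Q w -> z \in K -> pi (act w z) = act' (pi w) z.

(** Summation over the fibres of an equivariant map is the transfer. The map is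
only required to be equivariant on a stable part [Q] of the set. *)
Lemma gact_sum (E : Om -> V) w' x : x \in K ->
  (\sum_(w | Q w && (pi w == act' w' x)) E w =
   \sum_(w | Q w && (pi w == w')) E (act w x))%R.
Proof.
move=> Kx; rewrite (reindex_inj (gact_inj aK Kx)) /=.
apply: eq_bigl => w; rewrite QE //; case Qw: (Q w) => //=.
by rewrite piE // (inj_eq (gact_inj aK' Kx)).
Qed.

Lemma gcocyc_push (F : Om -> gT -> gT -> V) :
    gcocyc K act F ->
  gcocyc K act' (fun w' x y => \sum_(w | Q w && (pi w == w')) F w x y)%R.
Proof.
move=> cF w' x y z Kx Ky Kz.
rewrite gact_sum // -!(sumrB, big_split) /=.
by rewrite big1 // => w _; apply: cF.
Qed.

Lemma gcobound_push (F : Om -> gT -> gT -> V) :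
    gcobound K act F ->
  gcobound K act' (fun w' x y => \sum_(w | Q w && (pi w == w')) F w x y)%R.
Proof.
move=> [c cE]; exists (fun w' x => \sum_(w | Q w && (pi w == w')) c w x)%R.
move=> w' x y Kx Ky; rewrite gact_sum //.
by rewrite -!(sumrB, big_split) /=; apply: eq_bigr => w _; apply: cE.
Qed.

End Pushforward.

Lemma gact_unit (K : {set gT}) : gact K (fun (w : unit) _ => w).
Proof. by split. Qed.

Lemma cocyc_push (Om : finType) K (act : Om -> gT -> Om)
    (F : Om -> gT -> gT -> V) :
  gact K act -> gcocyc K act F -> cocyc K (fun x y => \sum_w F w x y)%R.
Proof.
move=> aK cF; apply/cocyc_gcocyc.
exact: (gcocyc_push (Q := predT) (pi := fun=> tt) aK (gact_unit K) _ _ cF).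
Qed.

Lemma cobound_push (Om : finType) K (act : Om -> gT -> Om)
    (F : Om -> gT -> gT -> V) :
  gact K act -> gcobound K act F -> cobound K (fun x y => \sum_w F w x y)%R.
Proof.
move=> aK cF.
have [//|//|c cE] :=
  gcobound_push (Q := predT) (pi := fun=> tt) aK (gact_unit K) _ _ cF.
by exists (c tt) => x y Kx Ky; apply: (cE tt).
Qed.

Lemma gcocyc_if (Om : Type) K (act : Om -> gT -> Om) (Q : pred Om)
    (F : Om -> gT -> gT -> V) :
    (forall w x, x \in K -> Q (act w x) = Q w) -> gcocyc K act F ->
  gcocyc K act (fun w x y => if Q w then F w x y else 0)%R.
Proof.
move=> QE cF w x y z Kx Ky Kz; rewrite QE //; case: (Q w); first exact: cF.
by rewrite !subr0 addr0.
Qed.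

Lemma cobound_pull (A B : {set gT}) (h : gT -> gT) f :
    (forall x, x \in A -> h x \in B) ->
    (forall x y, x \in A -> y \in A -> h (x * y) = h x * h y) ->
  cobound B f -> cobound A (fun x y => f (h x) (h y)).
Proof.
move=> hB hM [c cE]; exists (fun x => c (h x)) => x y Ax Ay.
by rewrite cE ?hB // hM.
Qed.

Section Twist.

Variables (U : Type) (K P : {group gT}).
Variables (actU : U -> gT -> U) (kap : U -> gT -> gT).
Hypothesis aU : gact K actU.
Hypothesis kapP : forall u x, x \in K -> kap u x \in P.
Hypothesis kapM : forall u x y, x \in K -> y \in K ->
  kap u (x * y) = kap u x * kap (actU u x) y.

Lemma kap1 u : kap u 1 = 1.
Proof.
have := kapM u (group1 K) (group1 K); rewrite mulg1 (proj1 aU).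
by rewrite -[LHS]mulg1 => /mulgI.
Qed.

(** [kap] is a functor from the action groupoid of [U] to [P]; a [P]-set is
pulled back along it to a set with an action of [K] that lies over [U]. When
[kap] comes from a transversal of cosets this composes corestrictions. *)
Definition twact (Om : Type) (act : Om -> gT -> Om) (uw : U * Om) x :=
  (actU uw.1 x, act uw.2 (kap uw.1 x)).

Definition twist (Om : Type) (F : Om -> gT -> gT -> V) (uw : U * Om) x y :=
  F uw.2 (kap uw.1 x) (kap (actU uw.1 x) y).

Lemma gact_twist (Om : Type) (act : Om -> gT -> Om) :
  gact P act -> gact K (twact act).
Proof.
move=> [a1 aM]; split=> [[u w]|[u w] x y Kx Ky].
  by rewrite /twact /= kap1 a1 (proj1 aU).
by rewrite /twact /= (proj2 aU) // kapM // aM ?kapP.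
Qed.

Lemma gcocyc_twist (Om : Type) (act : Om -> gT -> Om) F :
  gcocyc P act F -> gcocyc K (twact act) (twist F).
Proof.
move=> cF [u w] x y z Kx Ky Kz; rewrite /twist /twact /=.
rewrite (proj2 aU) // !kapM //.
by apply: cF; rewrite ?kapP.
Qed.

Lemma gcocyc_twist1 f :
  cocyc P f -> gcocyc K actU (fun u x y => f (kap u x) (kap (actU u x) y)).
Proof.
move=> cf u x y z Kx Ky Kz; rewrite (proj2 aU) // !kapM //.
by apply: cf; rewrite ?kapP.
Qed.

Lemma gcobound_twist1 f :
  cobound P f -> gcobound K actU (fun u x y => f (kap u x) (kap (actU u x) y)).
Proof.
move=> [c cE]; exists (fun u x => c (kap u x)) => u x y Kx Ky.
by rewrite cE ?kapP // kapM.
Qed.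

(** Functors into a group that differ by a natural transformation, here [s],
induce the same map in cohomology. *)
Lemma gcobound_homotopy (G : {group gT}) (Q : pred U) (s : U -> gT) f :
    cocyc G f -> K \subset G -> P \subset G ->
    (forall u x, x \in K -> Q (actU u x) = Q u) ->
    (forall u, Q u -> s u \in G) ->
    (forall u x, Q u -> x \in K -> kap u x * s (actU u x) = s u * x) ->
  gcobound K actU
    (fun u x y => if Q u then f (kap u x) (kap (actU u x) y) - f x y else 0)%R.
Proof.
move=> cf /subsetP sKG /subsetP sPG QE Gs sE.
exists (fun u x => if Q u then f (kap u x) (s (actU u x)) - f (s u) x else 0)%R.
move=> u x y Kx Ky; rewrite QE //; case Qu: (Q u); last by rewrite subrr addr0.
have Qux : Q (actU u x) by rewrite QE.
have Quxy : Q (actU (actU u x) y) by rewrite QE.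
have Gk v z : z \in K -> kap v z \in G by move=> Kz; rewrite sPG ?kapP.
have X0 := cf (s u) x y (Gs u Qu) (sKG x Kx) (sKG y Ky).
have Y0 := cf (kap u x) (s (actU u x)) y (Gk _ _ Kx) (Gs _ Qux) (sKG y Ky).
have := cf (kap u x) (kap (actU u x) y) (s (actU (actU u x) y))
  (Gk _ _ Kx) (Gk _ _ Ky) (Gs _ Quxy).
rewrite -sE // in X0; rewrite -[(s (actU u x) * y)%g]sE // in Y0.
rewrite -kapM // => /(congr1 (@GRing.opp V)); rewrite oppr0 (proj2 aU) // => Z0.
by apply: (eq_lin3 Y0 X0 Z0); zmodule.
Qed.

End Twist.

Lemma cobound_conj K f g : cocyc K f -> g \in K ->
  cobound K (fun x y => f (x ^ g)%g (y ^ g)%g - f x y)%R.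
Proof.
move=> cf Kg.
have [||||||c cE] := @gcobound_homotopy unit K K (fun w _ => w)
  (fun _ x => x ^ g) _ _ _ K predT (fun=> g^-1) f cf (subxx _) (subxx _) _.
- exact: gact_unit.
- by move=> _ x Kx; rewrite memJ_norm // (subsetP (normG K)).
- by move=> _ x y _ _; rewrite conjMg.
- by [].
- by move=> _ _; rewrite groupV.
- by move=> _ x _ Kx; rewrite conjgE -mulgA mulgK.
by exists (c tt) => x y Kx Ky; apply: (cE tt).
Qed.

End Transport.

(** * Corestriction *)

Section Corestriction.

Variables (gT : finGroupType) (V : zmodType).
Implicit Types (f : gT -> gT -> V).

Definition sha (K : {set gT}) f :=
  forall A : {group gT}, A \subset K -> abelian A -> cobound A f.

Lemma shaS (K L : {set gT}) f : L \subset K -> sha K f -> sha L f.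
Proof. by move=> sLK sf A sAL; apply: sf; apply: subset_trans sLK. Qed.

Lemma eq_sha (K : {set gT}) f g :
  (forall x y, x \in K -> y \in K -> f x y = g x y) -> sha K f -> sha K g.
Proof.
move=> fg sf A sAK abA; apply: (eq_cobound _ (sf A sAK abA)) => x y Ax Ay.
by rewrite fg // (subsetP sAK).
Qed.

Lemma sha_cobound (K : {set gT}) f : cobound K f -> sha K f.
Proof. by move=> cf A sAK _; apply: coboundS cf. Qed.

Lemma shaB (K : {set gT}) f g :
  sha K f -> sha K g -> sha K (fun x y => f x y - g x y)%R.
Proof. by move=> sf sg A sAK abA; apply: coboundB; [apply: sf|apply: sg]. Qed.

Lemma sha_pull (A P : {group gT}) (h : gT -> gT) f :
    abelian A -> (forall x, x \in A -> h x \in P) ->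
    (forall x y, x \in A -> y \in A -> h (x * y) = h x * h y) ->
  sha P f -> cobound A (fun x y => f (h x) (h y)).
Proof.
move=> abA hP hM sf; pose phi := Morphism hM.
apply: (cobound_pull (B := phi @* A)) => [x Ax|//|].
  exact: (mem_morphim phi).
apply: sf; last exact: morphim_abelian.
by apply/subsetP=> _ /morphimP[x Ax _ ->]; apply: hP.
Qed.

Variables (G H : {group gT}).
Hypothesis sHG : H \subset G.

(** The element of [H] by which right multiplication by [x] differs from the
change of coset representatives. The value [1] outside the cosets keeps the
cocycle rule [coset_shiftM] valid everywhere. *)
Definition coset_shift (u : {set gT}) x :=
  if u \in rcosets H G then repr u * x * (repr (u :* x))^-1 else 1.

Definition cor f x y :=
  (\sum_(u in rcosets H G) f (coset_shift u x) (coset_shift (u :* x)%g y))%R.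

Lemma gact_rcoset (K : {set gT}) : gact K (fun (u : {set gT}) x => u :* x).
Proof. by split=> [u|u x y _ _]; rewrite ?rcoset1 ?rcosetM. Qed.

Lemma rcosets_rmul u x : x \in G ->
  (u :* x \in rcosets H G) = (u \in rcosets H G).
Proof.
move=> Gx; apply/rcosetsP/rcosetsP=> -[g Gg].
  move=> uxE; exists (g * x^-1); first by rewrite groupM ?groupV.
  by rewrite rcosetM -uxE -rcosetM mulgV rcoset1.
by move->; exists (g * x); rewrite ?groupM ?rcosetM.
Qed.

Lemma repr_rcosets u : u \in rcosets H G -> H :* repr u = u /\ repr u \in G.
Proof.
case/rcosetsP=> g Gg ->; rewrite rcoset_repr; split=> //.
have /rcosetP[h Hh ->] := mem_repr_rcoset H g.
by rewrite groupM // (subsetP sHG).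
Qed.

Lemma coset_shift_in u x : x \in G -> coset_shift u x \in H.
Proof.
rewrite /coset_shift => Gx; case: ifP => // uG.
have uxG : u :* x \in rcosets H G by rewrite rcosets_rmul.
rewrite -mem_rcoset (proj1 (repr_rcosets uxG)) -{2}(proj1 (repr_rcosets uG)).
by rewrite -rcosetM rcoset_refl.
Qed.

Lemma coset_shiftM u x y : x \in G -> y \in G ->
  coset_shift u (x * y) = coset_shift u x * coset_shift (u :* x) y.
Proof.
move=> Gx Gy; rewrite /coset_shift rcosets_rmul //.
by case: ifP => _; rewrite ?mulg1 // rcosetM !mulgA mulgKV.
Qed.

Lemma cor_gcocyc (K : {group gT}) f : K \subset G -> cocyc H f ->
  gcocyc K (fun u x => u :* x) (fun u x y => if u \in rcosets H G then
     f (coset_shift u x) (coset_shift (u :* x) y) else 0)%R.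
Proof.
move=> sKG cf; apply: gcocycS sKG _.
apply: (gcocyc_if (Q := fun u => u \in rcosets H G)).
  by move=> u x Gx; rewrite rcosets_rmul.
apply: (gcocyc_twist1 (P := H) _ _ _ cf).
- exact: gact_rcoset.
- by move=> u x; apply: coset_shift_in.
- by move=> u x y; apply: coset_shiftM.
Qed.

Lemma corE f x y :
  cor f x y = (\sum_u if u \in rcosets H G then
     f (coset_shift u x) (coset_shift (u :* x)%g y) else 0)%R.
Proof. by rewrite /cor big_mkcond. Qed.

Lemma cor_cocyc f : cocyc H f -> cocyc G (cor f).
Proof.
move=> cf; have := cocyc_push (gact_rcoset G) (cor_gcocyc (subxx G) cf).
by move=> c x y z Gx Gy Gz; rewrite !corE; apply: c.
Qed.

Lemma cor_cobound f : cobound H f -> cobound G (cor f).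
Proof.
move=> [c cE]; exists (fun x => \sum_(u in rcosets H G) c (coset_shift u x))%R.
move=> x y Gx Gy; rewrite /cor.
have -> : (\sum_(u in rcosets H G) c (coset_shift u y) =
           \sum_(u in rcosets H G) c (coset_shift (u :* x)%g y))%R.
  rewrite (reindex_inj (gact_inj (gact_rcoset G) Gx)) /=.
  by apply: eq_bigl => u; rewrite rcosets_rmul.
rewrite -!(sumrB, big_split) /=; apply: eq_bigr => u uG.
by rewrite cE ?coset_shift_in // coset_shiftM.
Qed.

Lemma corB f g x y :
  cor (fun x y => f x y - g x y)%R x y = (cor f x y - cor g x y)%R.
Proof. exact: sumrB. Qed.

(** Over an abelian [A] the sum defining [cor f] runs over an [A]-set. Its
stabilisers are mapped by [coset_shift] to abelian subgroups of [H], where [f]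
is a coboundary, and Shapiro's lemma applies. *)
Lemma cor_sha f : cocyc H f -> sha H f -> sha G (cor f).
Proof.
move=> cf sf A sAG abA; have aA := gact_rcoset A.
suffices stabE :
    forall u, cobound (gstab A (fun u x => u :* x) u)
      (fun x y => if u \in rcosets H G then
         f (coset_shift u x) (coset_shift (u :* x) y) else 0)%R.
  have cG := gcobound_stab aA (cor_gcocyc sAG cf) stabE.
  have [c cE] := cobound_push aA cG.
  by exists c => x y Ax Ay; rewrite corE; apply: cE.
move=> u; case uG: (u \in rcosets H G); last exact: cobound0.
pose B := Group (group_set_gstab u aA).
have sBA : B \subset A by apply/subsetP=> x; rewrite inE => /andP[].
have uB x : x \in B -> u :* x = u by rewrite inE => /andP[_ /eqP].
apply: (@eq_cobound _ _ B (fun x y => f (coset_shift u x) (coset_shift u y))).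
  by move=> x y Bx _; rewrite (uB x Bx).
apply: sha_pull sf => [|x Bx|x y Bx By]; first exact: abelianS abA.
  by rewrite coset_shift_in // (subsetP sAG) // (subsetP sBA).
by rewrite coset_shiftM ?(subsetP sAG) ?(subsetP sBA) // (uB x Bx).
Qed.

(** Each summand of [cor f] is cohomologous to [f]: the coset representatives
form a natural transformation. *)
Lemma cor_res f : cocyc G f ->
  cobound G (fun x y => cor f x y - f x y *+ #|G : H|)%R.
Proof.
move=> cf; have aG := gact_rcoset G.
have [|||||d dE] := gcobound_homotopy (P := H) (kap := coset_shift)
    (Q := fun u => u \in rcosets H G) (s := fun u => repr u)
    aG _ _ cf (subxx _) sHG.
- by move=> u x; apply: coset_shift_in.
- by move=> u x y; apply: coset_shiftM.
- by move=> u x; apply: rcosets_rmul.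
- by move=> u /repr_rcosets[].
- by move=> u x uG Gx; rewrite /coset_shift uG mulgKV.
have [c cE] := cobound_push aG (ex_intro _ d dE).
exists c => x y Gx Gy; rewrite -cE // -big_mkcond sumrB sumr_const.
by rewrite cardE -cardE.
Qed.

End Corestriction.

(** * Sums and iterated differences *)

Section Newton.
Local Open Scope ring_scope.

Variable V : zmodType.
Implicit Types g : nat -> V.

Definition delta g i := g i.+1 - g i.

Lemma iter_delta_shift k g i :
  iter k delta (fun j => g j.+1) i = iter k delta g i.+1.
Proof. by elim: k i => //= k IHk i; rewrite /delta !IHk. Qed.

(** Newton's forward difference formula, summed. *)
Lemma sum_iter_delta n g :
  \sum_(i < n) g i = \sum_(k < n) iter k delta g 0%N *+ 'C(n, k.+1).
Proof.
elim: n g => [|n IHn] g; first by rewrite !big_ord0.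
rewrite big_ord_recl /= (IHn (fun i => g i.+1)).
have E k : iter k delta (fun j => g j.+1) 0%N =
    iter k delta g 0%N + iter k.+1 delta g 0%N.
  by rewrite iter_delta_shift iterS [delta _ 0%N]/delta addrC subrK.
under [X in _ + X]eq_bigr do rewrite E mulrnDl.
rewrite big_split /=.
under [RHS]eq_bigr do rewrite binS mulrnDr.
rewrite big_split /= addrCA; congr (_ + _).
  by rewrite big_ord_recr /= bin_small // mulr0n addr0.
by rewrite [RHS]big_ord_recl /= bin0.
Qed.

(** In a group of exponent [p] only the last term of the expansion survives. *)
Lemma sum_iter_delta_prime p g : prime p -> (forall x : V, x *+ p = 0) ->
  \sum_(i < p) g i = iter p.-1 delta g 0%N.
Proof.
move=> p_pr pV; rewrite sum_iter_delta.
case: p p_pr pV => // p p_pr pV; rewrite big_ord_recr /= binn mulr1n.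
rewrite big1 ?add0r // => k _.
have /dvdnP[m ->] : (p.+1 %| 'C(p.+1, k.+1))%N.
  by apply: prime_dvd_bin => //=; rewrite ltnS ltn_ord.
by rewrite mulrnA pV.
Qed.

End Newton.

(** * Extending characters of finite groups *)

Section Characters.

Variables (gT : finGroupType).
Implicit Types (A B V H : {group gT}) (l : gT -> QmodZ).

Definition hom_on (A : {set gT}) l :=
  forall x y, x \in A -> y \in A -> l (x * y) = (l x + l y)%R.

Lemma hom_on1 A l : hom_on A l -> l 1 = 0%R.
Proof.
move=> /(_ 1 1 (group1 A) (group1 A)); rewrite mulg1 -{1}[l 1]addr0.
by move=> /addrI.
Qed.

Lemma hom_onX A l x n : hom_on A l -> x \in A -> l (x ^+ n) = (l x *+ n)%R.
Proof.
move=> lA Ax; elim: n => [|n IH]; first by rewrite mulr0n (hom_on1 lA).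
by rewrite expgS lA ?groupX // IH mulrS.
Qed.

Lemma hom_onV A l x : hom_on A l -> x \in A -> l x^-1 = (- l x)%R.
Proof.
move=> lA Ax; apply/eqP; rewrite -subr_eq0 opprK -lA ?groupV // mulVg.
by rewrite (hom_on1 lA).
Qed.

(** Divisibility of the target provides the value at a new generator. *)
Lemma hom_on_extend1 A V l x :
    abelian A -> V \subset A -> x \in A -> hom_on V l ->
  exists2 l', hom_on (V <*> <[x]>) l' & {in V, l' =1 l}.
Proof.
move=> abA sVA Ax lV.
have nVA : A \subset 'N(V) by apply: sub_abelian_norm.
have nVx : x \in 'N(V) := subsetP nVA x Ax.
pose m := #[coset V x].
have Vxm : x ^+ m \in V.
  by rewrite coset_idr ?groupX // morphX // expg_order.
have mP d : x ^+ d \in V -> m %| d.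
  by move=> Vxd; rewrite order_dvdn -morphX //= coset_id.
have m_gt0 : 0 < m by apply: order_gt0.
have [q /eqP qE] := QmodZ_divisible (l (x ^+ m)) m_gt0.
have lxd d : x ^+ d \in V -> l (x ^+ d) = (q *+ d)%R.
  move=> /mP /dvdnP[k ->]; rewrite mulnC expgM (hom_onX _ lV) // -qE.
  by rewrite -mulrnA.
have wd v w i j : v \in V -> w \in V -> v * x ^+ i = w * x ^+ j ->
    (l v + q *+ i = l w + q *+ j)%R.
  wlog le_ij : v w i j / (i <= j)%N.
    move=> IH Vv Vw E; case: (leqP i j) => [ij|/ltnW ji]; first exact: IH.
    by symmetry; apply: IH.
  move=> Vv Vw; rewrite -(subnK le_ij) expgD mulgA => /mulIg E.
  have Vd : x ^+ (j - i) \in V by rewrite -(groupMl _ Vw) -E.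
  by rewrite E lV // lxd // mulrnDr addrA.
pose P y (vi : gT * 'I_#[x]) := (vi.1 \in V) && (y == vi.1 * x ^+ vi.2).
pose l' y :=
  if [pick vi | P y vi] is Some vi then (l vi.1 + q *+ vi.2)%R else 0%R.
have l'E v i : v \in V -> l' (v * x ^+ i) = (l v + q *+ i)%R.
  move=> Vv; rewrite /l'; case: pickP => [[w j] /andP[/= Vw /eqP E]|].
    by symmetry; apply: wd.
  have lt_i : i %% #[x] < #[x] by rewrite ltn_mod order_gt0.
  move=> /(_ (v, Ordinal lt_i)); rewrite /P /= Vv.
  by rewrite expg_mod_order eqxx.
have nxV : <[x]> \subset 'N(V) by rewrite cycle_subG.
exists l' => [y z|v Vv]; last first.
  by have := l'E v 0 Vv; rewrite expg0 mulg1 mulr0n addr0.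
rewrite joingC norm_joinEl // normC //.
case/mulsgP=> v _ Vv /cycleP[i ->] -> /mulsgP[w _ Vw /cycleP[j ->] ->].
have cxw : commute (x ^+ i) w.
  by apply: (centsP abA); rewrite ?groupX // (subsetP sVA).
rewrite -mulgA (mulgA _ w) cxw -(mulgA w) -expgD mulgA !l'E ?groupM //.
by rewrite lV // mulrnDr addrACA.
Qed.

Lemma hom_on_extend_abelian A V l :
    abelian A -> V \subset A -> hom_on V l ->
  exists2 l', hom_on A l' & {in V, l' =1 l}.
Proof.
move=> abA; have [n] := ubnP (#|A| - #|V|).
elim: n V l => // n IHn V l; rewrite ltnS => leVn sVA lV.
have [sAV|/subsetPn[x Ax nVx]] := boolP (A \subset V).
  have /eqP/group_inj AV : A :==: V by rewrite eqEsubset sAV.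
  by exists l => //; rewrite AV.
have [l1 l1hom l1E] := hom_on_extend1 abA sVA Ax lV.
have sWA : V <*> <[x]> \subset A by rewrite join_subG sVA cycle_subG.
have ltVW : #|V| < #|V <*> <[x]>|.
  apply: proper_card; rewrite properE joing_subl.
  apply/subsetPn; exists x => //.
  by rewrite (subsetP (joing_subr _ _)) ?cycle_id.
have [|l2 l2hom l2E] := IHn (V <*> <[x]>)%G l1 _ sWA l1hom.
  apply: leq_trans leVn; apply: ltn_sub2l => //.
  exact: leq_trans ltVW (subset_leq_card sWA).
exists l2 => // v Vv.
by rewrite l2E ?l1E // (subsetP (joing_subl _ _)).
Qed.

End Characters.

(** The character factors through the image of [V] in the abelianisation of
[H]. *)
Lemma hom_on_extend (gT : finGroupType) (H V : {group gT}) (l : gT -> QmodZ) :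
    V \subset H -> hom_on V l -> {in V :&: H^`(1), forall x, l x = 0%R} ->
  exists2 l', hom_on H l' & {in V, l' =1 l}.
Proof.
move=> sVH lV l0; have nDH : H \subset 'N(H^`(1)) by apply: der_norm.
have nDV := subset_trans sVH nDH.
pose q x := coset H^`(1) x.
have qM x y : x \in H -> y \in H -> q (x * y) = q x * q y.
  by move=> Hx Hy; rewrite /q morphM // (subsetP nDH).
have wd v w : v \in V -> w \in V -> q v = q w -> l v = l w.
  move=> Vv Vw E; apply/eqP; rewrite -subr_eq0 -(hom_onV lV) // -lV ?groupV //.
  apply/eqP/l0; rewrite inE groupM ?groupV //=.
  apply: coset_idr; first by rewrite groupM ?groupV ?(subsetP nDV).
  rewrite -/(q _) qM ?groupV ?(subsetP sVH) // E.
  by rewrite -qM ?groupV ?(subsetP sVH) // mulgV /q morph1.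
pose lq u := if [pick v in V | u == q v] is Some v then l v else 0%R.
have lqE v : v \in V -> lq (q v) = l v.
  move=> Vv; rewrite /lq; case: pickP => [w /andP[Vw /eqP E]|/(_ v)].
    by symmetry; apply: wd.
  by rewrite Vv eqxx.
have lqV : hom_on (V / H^`(1)) lq.
  move=> _ _ /morphimP[v _ Vv ->] /morphimP[w _ Vw ->] /=.
  by rewrite -!/(q _) -qM ?(subsetP sVH) // !lqE ?groupM ?lV.
have sVH' : V / H^`(1) \subset H / H^`(1) by apply: quotientS.
have [l1 l1hom l1E] := hom_on_extend_abelian (der_abelian 0 H) sVH' lqV.
exists (fun x => l1 (q x)) => [x y Hx Hy|v Vv].
  by rewrite qM // l1hom ?mem_quotient.
by rewrite l1E ?mem_quotient ?lqE.
Qed.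

(** * Commutators in an extension of a group of small class *)

Section Commutators.

Variables (gT : finGroupType).
Implicit Types (A B C D E G M N : {group gT}).

Lemma three_subgroup_mod A B C N :
    A \subset 'N(N) -> B \subset 'N(N) -> C \subset 'N(N) ->
    [~: A, B, C] \subset N -> [~: B, C, A] \subset N ->
  [~: C, A, B] \subset N.
Proof.
move=> nA nB nC.
have nR (X Y : {group gT}) : X \subset 'N(N) -> Y \subset 'N(N) ->
    [~: X, Y] \subset 'N(N).
  by move=> nX nY; rewrite (subset_trans (commg_sub _ _)) // join_subG nX.
have subE (X Y Z : {group gT}) : X \subset 'N(N) -> Y \subset 'N(N) ->
    Z \subset 'N(N) ->
    ([~: X, Y, Z] \subset N) = ([~: X / N, Y / N, Z / N] == 1).
  move=> nX nY nZ; have nXY := nR X Y nX nY.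
  rewrite -(quotientR nX nY) -(quotientR nXY nZ) -subG1.
  by rewrite quotient_sub1 // (nR [~: X, Y]%G Z).
rewrite !subE // => /eqP E1 /eqP E2.
by apply/eqP; apply: three_subgroup.
Qed.

Lemma lcn_comm G m n : [~: 'L_m.+1(G), 'L_n.+1(G)] \subset 'L_(m + n).+2(G).
Proof.
elim: m n => [|m IHm] n; first by rewrite lcn1 commGC add0n lcnSn.
have nL k : G \subset 'N('L_k(G)) := lcn_norm k G.
have nLL i k : 'L_i(G) \subset 'N('L_k(G)) := subset_trans (lcn_sub i G) (nL k).
rewrite lcnSn addSn.
apply: (three_subgroup_mod (nL _) (nLL _ _) (nLL _ _)) => /=.
  by rewrite (commGC G 'L_n.+1(G)) -lcnSn commGC -addnS IHm.
by rewrite lcnSn commSg // commGC.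
Qed.

(** This turns statements about iterated commutators with [E] into inclusions,
which the three subgroup lemma handles one step at a time. *)
Lemma sub_ucnS (E : {group gT}) (B : {set gT}) k :
  B \subset E -> ([~: B, E] \subset 'Z_k(E)) = (B \subset 'Z_k.+1(E)).
Proof.
move=> sBE; apply/idP/idP=> [sBZ|sBZ]; last first.
  by apply: subset_trans (ucn_comm k E); apply: commSg.
apply/subsetP=> x Bx; rewrite ucnSnR inE (subsetP sBE) //=.
by apply: subset_trans sBZ; rewrite commSg ?sub1set.
Qed.

(** Each commutator with [E] trades, by the three subgroup lemma, a commutator
of terms of the lower central series for commutators of deeper terms; once the
depths add up to more than [p], nothing is left. *)
Lemma commg_sub_ucn E M p k m n :
    M <| E ->
    (forall i j, p <= (i + j).+1 ->
       [~: 'L_i.+1(E) :&: M, 'L_j.+1(E) :&: M] = 1) ->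
    p <= (m + n).+1 + k ->
  [~: 'L_m.+1(E) :&: M, 'L_n.+1(E) :&: M] \subset 'Z_k(E).
Proof.
move=> nsME comm1; have [sME nME] := andP nsME.
pose T i := ('L_i.+1(E) :&: M)%G.
have nT i : E \subset 'N(T i) by rewrite normsI // lcn_norm.
have sT i : T i \subset E by rewrite subIset // lcn_sub.
have TS i : [~: T i, E] \subset T i.+1.
  rewrite /T /= subsetI lcnSn commSg ?subsetIl //.
  by apply: subset_trans (commSg _ (subsetIr _ _)) _; rewrite commg_subl.
rewrite -/(T m : {set gT}) -/(T n : {set gT}).
elim: k m n => [|k IHk] m n le_p.
  rewrite addn0 in le_p; have T1 : [~: T m, T n] = 1 := comm1 m n le_p.
  by rewrite T1 sub1G.
have sTT i j : [~: T i, T j] \subset E.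
  by rewrite (subset_trans (commg_sub _ _)) // join_subG !sT.
rewrite -sub_ucnS ?sTT //.
have nZ := ucn_norm k E.
have nZT i : T i \subset 'N('Z_k(E)) := subset_trans (sT i) nZ.
apply: (three_subgroup_mod (nZT n) nZ (nZT m)).
  apply: subset_trans (commSg _ (TS n)) _; rewrite commGC; apply: IHk.
  by rewrite addnS addSn -addnS.
rewrite (commGC E (T m)); apply: subset_trans (commSg _ (TS m)) _.
by apply: IHk; rewrite addSn addSn -addnS.
Qed.

End Commutators.

(** * The group extension attached to a cocycle *)

Section Extension.

Variables (gT : finGroupType) (P : {group gT}) (Om : finType).
Variables (act : Om -> gT -> Om) (A : finZmodType).
Variables (F : Om -> gT -> gT -> A).

(** The extension of [P] by the module of functions from [Om] to [A] that
corresponds to [F]. The cocycle is not normalised, whence the values at [(1, 1)]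
in the unit and in the embedding [gext_ker] of the functions. *)
Definition gext of gact P act & gcocyc P act F :=
  (subg_of P * {ffun Om -> A})%type.

Variables (aP : gact P act) (cF : gcocyc P act F).
Local Notation E := (gext aP cF).

HB.instance Definition _ := Finite.on E.

Definition gext_mul (a b : E) : E :=
  ((a.1 * b.1)%g,
   [ffun w => a.2 w + b.2 (act w (val a.1)) + F w (val a.1) (val b.1)]%R).

Definition gext_one : E := (1%g, [ffun w => - F w 1%g 1%g]%R).

Definition gext_inv (a : E) : E :=
  (a.1^-1%g,
   [ffun w => - F w 1%g 1%g - a.2 (act w (val a.1)^-1%g)
              - F w (val a.1)^-1%g (val a.1)]%R).

Lemma gcocyc1l w y : y \in P -> F w 1 y = F w 1 1.
Proof.
move=> Py; have := cF w (group1 P) (group1 P) Py.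
by rewrite !mul1g (proj1 aP) subrr add0r => /eqP; rewrite subr_eq0 => /eqP.
Qed.

Lemma gcocyc1r w x : x \in P -> F w x 1 = F (act w x) 1 1.
Proof.
move=> Px; have := cF w Px (group1 P) (group1 P).
by rewrite !mulg1 addrNK => /eqP; rewrite subr_eq0 => /eqP.
Qed.

Lemma gext_mulA : associative gext_mul.
Proof.
move=> [x v] [y w] [z u]; congr (_, _); first exact: mulgA.
apply/ffunP=> o; rewrite !ffunE /=.
have := cF o (valP x) (valP y) (valP z).
rewrite (proj2 aP) ?(valP x, valP y) //.
by move=> Z0; apply: (eq_lin3 Z0 (erefl 0%R) (erefl 0%R)); zmodule.
Qed.

Lemma gext_mul1 : left_id gext_one gext_mul.
Proof.
move=> [x v]; congr (_, _); first exact: mul1g.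
apply/ffunP=> o; rewrite !ffunE /= (proj1 aP) gcocyc1l ?(valP x) //; zmodule.
Qed.

Lemma gext_mulV : left_inverse gext_one gext_inv gext_mul.
Proof.
move=> [x v]; congr (_, _); first exact: mulVg.
apply/ffunP=> o; rewrite !ffunE /=; zmodule.
Qed.

HB.instance Definition _ :=
  Finite_isGroup.Build E gext_mulA gext_mul1 gext_mulV.

Definition gext_proj (a : E) : gT := val a.1.

Lemma gext_projM : {in [set: E] &, {morph gext_proj : a b / a * b}}.
Proof. by []. Qed.

Canonical gext_proj_morphism := Morphism gext_projM.

Definition gext_ker (v : {ffun Om -> A}) : E :=
  (1%g, [ffun w => v w - F w 1%g 1%g]%R).

Lemma gext_kerM v w : gext_ker (v + w)%R = gext_ker v * gext_ker w.
Proof.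
congr (_, _); first by rewrite mulg1.
apply/ffunP=> o; rewrite !ffunE /= (proj1 aP); zmodule.
Qed.

Lemma gext_ker0 : gext_ker 0%R = 1.
Proof. by congr (_, _); apply/ffunP=> o; rewrite !ffunE add0r. Qed.

Lemma gext_ker_inj : injective gext_ker.
Proof.
move=> v w [] /ffunP E; apply/ffunP=> o; have := E o; rewrite !ffunE.
exact: addIr.
Qed.

Lemma gext_kerP a : gext_proj a = 1 -> exists v, a = gext_ker v.
Proof.
case: a => x v xE; have {}xE : x = 1%g by apply: val_inj.
exists [ffun w => v w + F w 1%g 1%g]%R; rewrite xE; congr (_, _).
by apply/ffunP=> o; rewrite !ffunE addrK.
Qed.

(** A commutator with the kernel is a difference of functions, so membership in
the upper central series is the vanishing of iterated differences. *)
Lemma gext_kerR v (t : subg_of P) (a : E) : a.1 = t ->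
  [~ gext_ker v, a] = gext_ker [ffun w => v (act w (val t)^-1%g) - v w]%R.
Proof.
move=> <-; apply: (mulgI (gext_ker v)); apply: (mulgI a).
have -> : a * (gext_ker v * [~ gext_ker v, a]) = gext_ker v * a.
  by rewrite commgEl conjgE mulKVg mulKVg.
rewrite -gext_kerM.
have Pa : val a.1 \in P by apply: valP.
congr (_, _); first by rewrite mulg1 mul1g.
apply/ffunP=> o; rewrite !ffunE /= (proj1 aP) gcocyc1l // (gcocyc1r o Pa).
rewrite (gactK aP) //; zmodule.
Qed.

Lemma gext_ker_ucn v t k : t \in P -> gext_ker v \in 'Z_k([set: E]) ->
  iter k (fun u : {ffun Om -> A} => [ffun w => u (act w t) - u w]%R) v = 0%R.
Proof.
move=> Pt; elim: k v => [|k IHk] v.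
  by rewrite ucn0 => /set1P; rewrite -gext_ker0 => /gext_ker_inj.
move=> Zv; rewrite iterSr; apply: IHk.
pose a : E := (subg P t^-1, 0%R).
suff -> : gext_ker [ffun w => v (act w t) - v w]%R = [~ gext_ker v, a].
  exact: (subsetP (ucn_comm k [set: E]%G)) (mem_commg Zv (in_setT a)).
rewrite (@gext_kerR v (subg P t^-1) a (erefl _)); congr gext_ker.
by apply/ffunP=> o; rewrite !ffunE subgK ?groupV // invgK.
Qed.

Variable M : {group gT}.
Hypothesis nsMP : M <| P.
Hypothesis actM1 : forall w x, x \in M -> act w x = w.
Hypothesis symF : forall w x y, x \in M -> y \in M -> commute x y ->
  F w x y = F w y x.

Definition gext_over : {group E} := (gext_proj @*^-1 M)%G.

Lemma gext_overP a : (a \in gext_over) = (gext_proj a \in M).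
Proof. by rewrite !inE. Qed.

Lemma gext_over_normal : gext_over <| [set: E].
Proof.
apply/andP; split; first exact: subsetT.
apply/subsetP=> a _; rewrite inE; apply/subsetP=> _ /imsetP[b Mb ->].
rewrite gext_overP /conjg /gext_proj /= -!/(val _).
rewrite memJ_norm -?gext_overP // (subsetP (normal_norm nsMP)) //.
exact: valP.
Qed.

(** The symmetry of [F] on commuting pairs is the form in which the vanishing of
the class on abelian subgroups is used. *)
Lemma gext_over_comm a b : a \in gext_over -> b \in gext_over ->
  commute (gext_proj a) (gext_proj b) -> commute a b.
Proof.
case: a b => [x v] [y w]; rewrite !gext_overP /gext_proj /= => Mx My cxy.
congr (_, _); first exact: val_inj.
apply/ffunP=> o; rewrite !ffunE /= !actM1 // symF //; zmodule.
Qed.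

Lemma gext_proj_lcn n : gext_proj @* 'L_n([set: E]) \subset 'L_n(P).
Proof.
rewrite morphim_lcn // lcnS //.
by apply/subsetP=> _ /morphimP[a _ _ ->]; apply: valP.
Qed.

(** Elements of the preimage of [M] that lie deep enough in the lower central
series of the extension have commuting images, hence commute. *)
Lemma gext_der_ucn p : nilpotent P -> nil_class P <= p ->
  gext_over^`(1) \subset 'Z_p.-1([set: E]).
Proof.
move=> nilP clP; have := @commg_sub_ucn _ [set: E]%G gext_over p p.-1 0 0.
rewrite lcn1 setTI; apply; first exact: gext_over_normal; last first.
  by rewrite addn0 add1n leqSpred.
move=> i j le_p; apply/commG1P/centsP=> a /setIP[La Ma] b /setIP[Lb Mb].
apply: gext_over_comm => //.
have Lp k c : c \in 'L_k([set: E]) -> gext_proj c \in 'L_k(P).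
  by move=> Lc; apply: (subsetP (gext_proj_lcn k)); rewrite mem_morphim ?inE.
have L1 : 'L_(i + j).+2(P) = 1.
  apply/trivgP; have /(lcn_nil_classP _ nilP) <- := leq_trans clP le_p.
  by [].
have : [~ gext_proj a, gext_proj b] \in 'L_(i + j).+2(P).
  by apply: (subsetP (lcn_comm P i j)); rewrite mem_commg ?Lp.
by rewrite L1 => /set1P/eqP/commgP.
Qed.

(** Along the orbit of [t] the function [v] behaves like a polynomial of degree
less than [p - 1], and the values of such a polynomial over [F_p] add up to
zero. *)
Lemma gext_der_sum p w0 t v : prime p -> (forall a : A, a *+ p = 0)%R ->
    nilpotent P -> nil_class P <= p -> t \in P ->
    bijective (fun i : 'I_p => act w0 (t ^+ i)) ->
  gext_ker v \in gext_over^`(1) -> (\sum_w v w = 0)%R.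
Proof.
move=> p_pr pA nilP clP Pt bij /(subsetP (gext_der_ucn nilP clP)).
move=> /(gext_ker_ucn Pt) v0.
rewrite (reindex _ (onW_bij _ bij)) /=.
pose g i := v (act w0 (t ^+ i)).
have gE k : forall i, iter k (@delta A) g i = iter k
    (fun u : {ffun Om -> A} => [ffun w => u (act w t) - u w]%R) v
      (act w0 (t ^+ i)).
  elim: k => //= k IHk i.
  by rewrite ffunE /delta !IHk expgSr (proj2 aP) ?groupX.
by rewrite (sum_iter_delta_prime g p_pr pA) gE v0 ffunE.
Qed.

(** Summing over [Om] defines a character of the kernel; since it kills the
commutators, it extends, and its values on a section split the sum of [F]. *)
Lemma cobound_sum_small_class p w0 t (iota : {additive A -> QmodZ}) :
    prime p -> (forall a : A, a *+ p = 0)%R ->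
    nilpotent P -> nil_class P <= p -> t \in P ->
    bijective (fun i : 'I_p => act w0 (t ^+ i)) ->
  cobound M (fun x y => \sum_w iota (F w x y))%R.
Proof.
move=> p_pr pA nilP clP Pt bij.
pose V := ('ker gext_proj)%G.
pose l (a : E) := iota (\sum_w (a.2 w + F w 1%g 1%g))%R.
have VP a : a \in V -> exists v, a = gext_ker v.
  by move=> /mker; apply: gext_kerP.
have lker v : l (gext_ker v) = iota (\sum_w v w)%R.
  by congr (iota _); apply: eq_bigr => w _; rewrite ffunE subrK.
have Vker v : gext_ker v \in V by apply/kerP; rewrite ?inE.
have lV : hom_on V l.
  move=> a b /VP[v ->] /VP[w ->]; rewrite -gext_kerM !lker -raddfD -big_split.
  by congr (iota _); apply: eq_bigr => o _; rewrite ffunE.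
have sVM : V \subset gext_over by rewrite morphpreS ?sub1G.
have l0 : {in V :&: gext_over^`(1), forall a, l a = 0%R}.
  move=> a /setIP[/VP[v ->] Mv].
  by rewrite lker (gext_der_sum _ _ _ _ _ bij Mv) ?raddf0.
have [l' l'hom l'E] := hom_on_extend sVM lV l0.
have sMP x : x \in M -> x \in P := subsetP (normal_sub nsMP) x.
pose s x : E := (subg P x, 0%R).
have Ms x : x \in M -> s x \in gext_over.
  by move=> Mx; rewrite gext_overP /gext_proj /= subgK ?sMP.
exists (fun x => l' (s x)) => x y Mx My.
have sM : s x * s y = gext_ker [ffun w => F w x y] * s (x * y).
  congr (_, _); first by rewrite mul1g -morphM ?sMP.
  apply/ffunP=> w; rewrite !ffunE /= !subgK ?groupM ?sMP //.
  rewrite gcocyc1l ?groupM ?sMP //; zmodule.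
have := congr1 l' sM.
rewrite (l'hom _ _ (Ms x Mx) (Ms y My)).
rewrite (l'hom _ _ (subsetP sVM _ (Vker _))) ?Ms ?groupM //.
rewrite (l'E _ (Vker _)) lker => E1.
have -> : (\sum_w iota (F w x y) = iota (\sum_w [ffun w => F w x y] w))%R.
  by rewrite raddf_sum; apply: eq_bigr => w _; rewrite ffunE.
by rewrite addrAC [(l' (s y) + _)%R]addrC E1 addrK.
Qed.

End Extension.

(** * The norm from a maximal subgroup *)

Section Torsion.

Local Open Scope ring_scope.
Local Open Scope quotient_scope.

Variable p : nat.
Hypothesis p_gt1 : (1 < p)%N.

(** The [p]-torsion of [Q/Z] as a finite group of coefficients, so that the
corresponding extensions are finite groups. The type ['Z_p] has [p] elements for
[1 < p], a fact that the argument makes available to the morphism instance. *)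
Definition Zp_QmodZ of (1 < p)%N := fun i : 'Z_p =>
  (\pi_QmodZ ((p%:R : rat)^-1) : QmodZ) *+ (i : nat).
Local Notation iota := (Zp_QmodZ p_gt1).

Let p_neq0 : (p%:R : rat) != 0.
Proof. by rewrite pnatr_eq0 -lt0n ltnW. Qed.

Lemma Zp_QmodZ_nat n : iota n%:R = (\pi_QmodZ ((p%:R : rat)^-1) : QmodZ) *+ n.
Proof.
rewrite /Zp_QmodZ val_Zp_nat // [in RHS](divn_eq n p) mulrnDr mulnC mulrnA.
rewrite -[X in X *+ _ + _]raddfMn /= -[_^-1 *+ p]mulr_natr mulVf //.
suff -> : \pi_QmodZ (1 : rat) = 0 :> QmodZ by rewrite mul0rn add0r.
apply/eqP; rewrite -(raddf0 \pi_QmodZ) -Quotient.idealrBE subr0.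
by apply/Num.Theory.intrP; exists 1.
Qed.

Fact Zp_QmodZ_is_zmod_morphism : zmod_morphism iota.
Proof.
move=> a b; apply/eqP; rewrite -subr_eq0 opprB addrA subr_eq0; apply/eqP.
have addE (c d : 'Z_p) : iota (c + d) = iota c + iota d.
  by rewrite -[c]natr_Zp -[d]natr_Zp -natrD !Zp_QmodZ_nat mulrnDr.
by rewrite -addE subrK.
Qed.

HB.instance Definition _ :=
  GRing.isZmodMorphism.Build 'Z_p QmodZ iota Zp_QmodZ_is_zmod_morphism.

Lemma Zp_QmodZ_inj : injective iota.
Proof.
apply: raddf_inj => i i0; have := Zp_QmodZ_nat i.
rewrite natr_Zp [LHS]i0 => /esym; rewrite -raddfMn /=.
rewrite -(raddf0 \pi_QmodZ) => /eqP; rewrite -Quotient.idealrBE subr0.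
rewrite -[_ *+ _]mulr_natl => /Num.Theory.intrP[m mE].
have {mE} : (i : nat)%:R = m%:~R * p%:R :> rat by rewrite -mE divfK.
rewrite -[p%:R]/(p%:Z%:~R) -[_%:R]/((i : nat)%:Z%:~R) -intrM => /intr_inj iE.
have : (p%:Z %| (i : nat)%:Z)%Z by apply/dvdzP; exists m.
rewrite dvdzE /= => p_i; apply: val_inj => /=; apply/eqP.
rewrite -leqn0 leqNgt; apply/negP=> i_gt0.
have := dvdn_leq i_gt0 p_i; rewrite leqNgt => /negP; apply.
by rewrite -[X in (_ < X)%N](Zp_cast p_gt1).
Qed.

Lemma Zp_QmodZ_surj (q : QmodZ) : q *+ p = 0 -> exists i, iota i = q.
Proof.
move=> /(QmodZ_torsion (ltnW p_gt1))[i /eqP <-]; exists (i%:R).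
by rewrite Zp_QmodZ_nat -raddfMn -[_ *+ _]mulr_natl.
Qed.

End Torsion.

Section Norm.

Variables (gT : finGroupType) (P : {group gT}) (p : nat).
Hypotheses (p_pr : prime p) (pP : p.-group P) (clP : nil_class P <= p).

Lemma cobound_commute (K : {set gT}) (V : zmodType) (f : gT -> gT -> V) x y :
  cobound K f -> x \in K -> y \in K -> commute x y -> f x y = f y x.
Proof. by move=> [c cE] Kx Ky cxy; rewrite !cE // cxy; zmodule. Qed.

Lemma sha_commute (K : {group gT}) (V : zmodType) (f : gT -> gT -> V) x y :
  sha K f -> x \in K -> y \in K -> commute x y -> f x y = f y x.
Proof.
move=> sf Kx Ky cxy; apply: (@cobound_commute (<[x]> <*> <[y]>)) => //.
- apply: (sf (<[x]> <*> <[y]>)%G).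
    by rewrite join_subG !cycle_subG Kx.
  by rewrite /= abelianY !cycle_abelian cents_cycle.
- by apply: (subsetP (joing_subl _ _)); apply: cycle_id.
- by apply: (subsetP (joing_subr _ _)); apply: cycle_id.
Qed.

Variable M : {group gT}.
Hypothesis maxM : maximal M P.

Let nsMP : M <| P := p_maximal_normal pP maxM.

Definition quotient_act (q : [subg P / M]) x := q * subg (P / M) (coset M x).

Lemma gact_quotient : gact P quotient_act.
Proof.
split=> [w|w x y Px Py].
  rewrite /quotient_act morph1 (_ : subg _ 1 = 1) ?mulg1 //.
  exact: morph1.
have nM z : z \in P -> z \in 'N(M) := subsetP (normal_norm nsMP) z.
rewrite /quotient_act morphM ?nM // -mulgA; congr (_ * _).
by rewrite subgM ?mem_quotient.
Qed.

Lemma quotient_maximal_cycle : exists2 t, t \in P &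
  bijective (fun i : 'I_p => quotient_act 1 (t ^+ i)).
Proof.
have nM z : z \in P -> z \in 'N(M) := subsetP (normal_norm nsMP) z.
have [_ /properP[sMP [t Pt nMt]]] := (maxM, maxgroupp maxM).
have cardPM : #|P / M| = p.
  by rewrite card_quotient ?normal_norm // (p_maximal_index pP maxM).
exists t => //; apply: inj_card_bij; last first.
  by rewrite card_ord -cardPM card_sub.
move=> i j; rewrite /quotient_act !mul1g.
move=> /(congr1 val); rewrite !subgK ?mem_quotient ?groupX //.
rewrite !morphX ?nM // => /eqP; rewrite eq_expg_mod_order.
have -> : #[coset M t] = p.
  have := order_dvdG (mem_quotient M Pt); rewrite cardPM.
  move=> /(primeP p_pr).2 /orP[]; last by move/eqP.
  by rewrite order_eq1 => /eqP/coset_idr-/(_ (nM t Pt)); rewrite (negPf nMt).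
by rewrite !modn_small // => /eqP/val_inj.
Qed.

(** The value of [F] at one coset is a cocycle [b] on [M], its other values are
cohomologous to conjugates of [b], and the sum is the norm of [b]. *)
Lemma cobound_quotient_sum (F : [subg P / M] -> gT -> gT -> QmodZ) :
    gcocyc P quotient_act F -> (forall q x y, F q x y *+ p = 0)%R ->
    (forall q, sha M (F q)) ->
  cobound M (fun x y => \sum_q F q x y)%R.
Proof.
move=> cF F_tors shaF.
have p_gt1 := prime_gt1 p_pr.
have /choice[F' F'E] : forall qxy : [subg P / M] * gT * gT,
    exists i, Zp_QmodZ p_gt1 i = F qxy.1.1 qxy.1.2 qxy.2.
  by move=> qxy; apply: Zp_QmodZ_surj.
pose f q x y := F' (q, x, y).
have fE q x y : Zp_QmodZ p_gt1 (f q x y) = F q x y by rewrite F'E.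
have cf : gcocyc P quotient_act f.
  move=> q x y z Px Py Pz; apply: (@Zp_QmodZ_inj _ p_gt1).
  by rewrite raddf0 -(cF q x y z Px Py Pz) !(raddfB, raddfD) /= !fE.
have [t Pt bij] := quotient_maximal_cycle.
apply: (@eq_cobound _ _ _ (fun x y => \sum_q Zp_QmodZ p_gt1 (f q x y))%R).
  by move=> x y _ _; apply: eq_bigr => q _; rewrite fE.
apply: (cobound_sum_small_class gact_quotient cf nsMP _ _ _ p_pr _ _ clP
  Pt bij).
- move=> q x Mx; rewrite /quotient_act coset_id //.
  by rewrite (_ : subg _ 1 = 1) ?mulg1 //; apply: morph1.
- move=> q x y Mx My cxy; apply: (@Zp_QmodZ_inj _ p_gt1); rewrite !fE.
  exact: sha_commute (shaF q) Mx My cxy.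
- by move=> a; rewrite -mulr_natr pchar_Zp // mulr0.
- exact: pgroup_nil pP.
Qed.

End Norm.

Section SmallStabilizers.

Variables (gT : finGroupType) (P : {group gT}) (p : nat).
Hypotheses (p_pr : prime p) (pP : p.-group P) (clP : nil_class P <= p).

Lemma gstab_act (Om : finType) (K : {group gT}) (act : Om -> gT -> Om) w x :
  gact K act -> x \in K -> gstab K act (act w x) = gstab K act w :^ x.
Proof.
move=> aK Kx; have [act1 actM] := aK; apply/setP=> y.
rewrite mem_conjg !inE groupJr ?groupV //; case Ky: (y \in K) => //=.
rewrite conjgE invgK !actM ?groupM ?groupV //.
apply/eqP/eqP=> [->|E]; first by rewrite (gactK aK).
by rewrite -[in LHS](gactKV aK Kx (act (act w x) y)) E.
Qed.

Variables (Om : finType) (act : Om -> gT -> Om).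
Variables (F : Om -> gT -> gT -> QmodZ).
Hypotheses (aP : gact P act) (cF : gcocyc P act F).
Hypothesis F_tors : forall w x y, (F w x y *+ p = 0)%R.
Hypothesis shaF : forall w, sha (gstab P act w) (F w).

Variable M : {group gT}.
Hypothesis maxM : maximal M P.

Let nsMP : M <| P := p_maximal_normal pP maxM.

(** An orbit whose stabilisers lie in [M] maps equivariantly to [P / M], hence
the sum over the points of such orbits is the norm of a class of [M], which
itself is a sum of corestrictions to [M]. *)
Lemma cobound_sum_stab_sub :
  cobound M (fun x y => \sum_(w | gstab P act w \subset M) F w x y)%R.
Proof.
pose Q w := gstab P act w \subset M.
have nM z : z \in P -> z \in 'N(M) := subsetP (normal_norm nsMP) z.
have QE w x : x \in P -> Q (act w x) = Q w.
  by move=> Px; rewrite /Q gstab_act // -{1}(normP (nM x Px)) conjSg.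
have [rt [Pt tE rE]] := orbit_transversal_choice aP.
pose phi w := subg (P / M) (coset M (rt w).2).
have phiE w x : Q w -> x \in P -> phi (act w x) = quotient_act (phi w) x.
  move=> Qw Px; rewrite /quotient_act /phi -subgM ?mem_quotient ?Pt //.
  rewrite -morphM ?nM ?Pt //; congr subg.
  have Qr : Q (rt w).1 by rewrite -(QE _ (rt w).2) ?Pt // tE.
  set h := (rt w).2 * x * (rt (act w x)).2^-1.
  have Mh : h \in M.
    apply: (subsetP Qr); rewrite inE !groupM ?groupV ?Pt //=.
    rewrite !(proj2 aP) ?groupM ?groupV ?Pt // tE.
    by rewrite -[X in act X _]tE rE // (gactK aP) ?Pt.
  rewrite -[(rt w).2 * x](mulgKV (rt (act w x)).2) -/h.
  have nMh : h \in 'N(M) := subsetP (normG M) h Mh.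
  by rewrite (morphM _ nMh (nM _ (Pt _))) /= (coset_id Mh) mul1g.
have aQ := gact_quotient pP maxM.
pose Fq q x y := (\sum_(w | Q w && (phi w == q)) F w x y)%R.
have cFq : gcocyc P (@quotient_act _ P M) Fq := gcocyc_push aP aQ QE phiE cF.
have sMP := normal_sub nsMP.
have := cobound_quotient_sum p_pr pP clP maxM cFq.
have E x y : (\sum_q Fq q x y = \sum_(w | Q w) F w x y)%R.
  by rewrite (partition_big phi predT).
move=> H; apply: eq_cobound (H _ _) => [x y _ _|q x y|q A sAM abA].
- exact: E.
- by rewrite -sumrMnl big1 // => w _; apply: F_tors.
have sAP := subset_trans sAM sMP.
have aA := gactS sAP aP.
pose FA w x y := (if Q w && (phi w == q) then F w x y else 0)%R.
have cFA : gcocyc A act FA.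
  apply: (gcocyc_if (Q := fun w => Q w && (phi w == q))).
    2: exact: gcocycS cF.
  move=> w x Ax; have Px := subsetP sAP x Ax; rewrite QE //.
  case Qw: (Q w) => //=.
  rewrite phiE // /quotient_act coset_id ?(subsetP sAM) //.
  by rewrite (_ : subg _ 1 = 1) ?mulg1 //; apply: morph1.
have sA w : cobound (gstab A act w) (FA w).
  rewrite /FA; case: (Q w && _); last exact: cobound0.
  pose B := Group (group_set_gstab w aA).
  apply: (shaF (A := B)); last first.
    by apply: abelianS abA; apply/subsetP=> x; rewrite inE => /andP[].
  by apply/subsetP=> x; rewrite !inE => /andP[Ax ->]; rewrite (subsetP sAP).
have [c cE] := cobound_push aA (gcobound_stab aA cFA sA).
by exists c => x y Ax Ay; rewrite -cE // /Fq big_mkcond.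
Qed.

End SmallStabilizers.

(** * Descent along double cosets *)

Section Descent.

Variables (gT : finGroupType) (G P : {group gT}) (p : nat).
Hypotheses (sPG : P \subset G) (p_pr : prime p) (pP : p.-group P).
Hypothesis clP : nil_class P <= p.

Local Notation kap := (coset_shift G P).
Local Notation rmul := (fun (u : {set gT}) (x : gT) => u :* x).

Let aU : gact P rmul := gact_rcoset P.

Let kapP u x : x \in P -> kap u x \in P.
Proof. by move=> Px; rewrite coset_shift_in // (subsetP sPG). Qed.

Let kapM u x y : x \in P -> y \in P -> kap u (x * y) = kap u x * kap (u :* x) y.
Proof. by move=> Px Py; rewrite coset_shiftM // (subsetP sPG). Qed.

(** The cosets fixed by [P] are those of [N_G(P)]; the others account for the
double cosets of [P] that contribute proper intersections of conjugates. *)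
Definition moved u := (u \in rcosets P G) && [exists x in P, u :* x != u].

Definition moved_sum (f : gT -> gT -> QmodZ) x y :=
  (\sum_(u | moved u) f (kap u x) (kap (u :* x)%g y))%R.

Lemma moved_rmul u x : x \in P -> moved (u :* x) = moved u.
Proof.
move=> Px; rewrite /moved rcosets_rmul ?(subsetP sPG) //; congr (_ && _).
apply/exists_inP/exists_inP=> -[y Py uy].
  exists (x * y * x^-1); first by rewrite !groupM ?groupV.
  apply: contra uy => /eqP uy.
  by rewrite -rcosetM -[X in _ == X :* x]uy -rcosetM mulgKV.
exists (y ^ x); first by rewrite groupJ.
rewrite conjgE -rcosetM mulKVg rcosetM.
by rewrite (inj_eq (gact_inj aU Px)).
Qed.

Lemma cobound_moved_sum f : cobound P f -> cobound P (moved_sum f).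
Proof.
move=> cf; have cU := gcobound_twist1 kapP kapM cf.
have [|//|c cE] :=
  gcobound_push (Q := moved) (pi := fun=> tt) aU (gact_unit P) _ _ cU.
  exact: moved_rmul.
exists (c tt) => x y Px Py; rewrite -cE //.
by apply: eq_bigl => u; rewrite andbT.
Qed.

(** If [u] is the coset of [g], its stabiliser in [P] is the intersection of [P]
with its conjugate by [g]; it is carried back by [g] to a subgroup of [P]. *)
Definition shifted_stab u := kap u @: gstab P rmul u.

Lemma shifted_stab_rmul (M : {group gT}) u x : M <| P -> x \in P ->
  (shifted_stab (u :* x) \subset M) = (shifted_stab u \subset M).
Proof.
move=> nsMP.
have half v y : y \in P ->
    shifted_stab v \subset M -> shifted_stab (v :* y) \subset M.
  move=> Py /subsetP sM; apply/subsetP=> _ /imsetP[z zS ->].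
  move: zS; rewrite inE => /andP[Pz /eqP vyz].
  have Pz' : y * z * y^-1 \in P by rewrite !groupM ?groupV.
  have vz' : v :* (y * z * y^-1) = v.
    by rewrite !rcosetM vyz -rcosetM mulgV rcoset1.
  have : kap v (y * z) = kap v ((y * z * y^-1) * y) by rewrite mulgKV.
  rewrite kapM // [in RHS]kapM // vz' => /(congr1 (fun g => (kap v y)^-1 * g)).
  rewrite mulKg => ->; rewrite -conjgE.
  rewrite memJ_norm; last by rewrite (subsetP (normal_norm nsMP)) ?kapP.
  have vS : y * z * y^-1 \in gstab P rmul v.
    by rewrite inE; apply/andP; split=> //; apply/eqP.
  exact/sM/(imset_f (kap v) vS).
move=> Px; apply/idP/idP; last exact: half.
by move/(half _ x^-1); rewrite groupV -rcosetM mulgV rcoset1; apply.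
Qed.

(** A choice that only depends on the orbit of [u], because it is made from a
predicate that does; the points whose contribution vanishes then form a stable
set. *)
Definition max_over u : {group gT} :=
  if [pick M : {group gT} | maximal M P && (shifted_stab u \subset M)] is Some M
  then M else P.

Lemma max_over_rmul u x : x \in P -> max_over (u :* x) = max_over u.
Proof.
move=> Px; rewrite /max_over; congr (if _ is Some M then M else P).
apply: eq_pick => M; case maxM: (maximal M P) => //=.
exact/shifted_stab_rmul/Px/(p_maximal_normal pP maxM).
Qed.

Lemma max_over_norm u : P \subset 'N(max_over u).
Proof.
rewrite /max_over; case: pickP => [M /andP[maxM _]|_]; last exact: normG.
exact: normal_norm (p_maximal_normal pP maxM).
Qed.

Lemma max_overP u : moved u ->
  maximal (max_over u) P /\ shifted_stab u \subset max_over u.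
Proof.
case/andP=> _ /exists_inP[x Px ux]; rewrite /max_over.
case: pickP => [M /andP[] //|no].
pose B := Group (group_set_gstab u aU).
have uB y : y \in B -> u :* y = u by rewrite inE => /andP[_ /eqP].
have sBP : B \subset P by apply/subsetP=> y; rewrite inE => /andP[].
have kM : {in B &, {morph kap u : y z / y * z}}.
  by move=> y z By Bz; rewrite kapM ?(subsetP sBP) // (uB y By).
pose D := (Morphism kM @* B)%G.
have DE : D :=: shifted_stab u := morphimEdom (Morphism kM).
have sDP : D \subset P.
  by rewrite DE; apply/subsetP=> _ /imsetP[y /(subsetP sBP) Py ->]; apply: kapP.
have ltDP : #|D| < #|P|.
  rewrite (leq_ltn_trans (leq_morphim _ _)) // proper_card // properE sBP.
  apply/subsetPn; exists x => //.
  by apply: contra ux => /uB ->.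
have [DP|[M maxM sDM]] := maximal_exists sDP.
  by rewrite DP ltnn in ltDP.
by have := no M; rewrite maxM -DE sDM.
Qed.

(** [f] is a sum of corestrictions, from subgroups of [P] with fewer than [m]
elements, of [p]-torsion classes that vanish on abelian subgroups. The subgroups
are the stabilisers of the points of one [P]-set. *)
Definition sum_from_small m (f : gT -> gT -> QmodZ) :=
  exists (Om : finType) (act : Om -> gT -> Om) (F : Om -> gT -> gT -> QmodZ),
    [/\ gact P act /\ gcocyc P act F,
        forall w x y, (F w x y *+ p = 0)%R,
        forall w, sha (gstab P act w) (F w),
        forall w, m <= #|gstab P act w| -> forall x y, F w x y = 0%R
      & cobound P (fun x y => f x y - \sum_w F w x y)%R].

Lemma sum_from_small0 f : sum_from_small 0 f -> cobound P f.
Proof.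
move=> [Om [act [F [_ _ _ F0]]]]; apply: eq_cobound => x y _ _.
by rewrite big1 ?subr0 // => w _; apply: F0.
Qed.

(** Substituting in [moved_sum f] the expression of [f] as a sum over [Om] gives
a sum over pairs [(u, w)]. The stabiliser of such a pair embeds, through [kap],
in the intersection of [shifted_stab u] with the stabiliser of [w]. Either the
latter is not contained in [max_over u] and the order drops, or the pairs over
[u] of this kind add up to a norm, which vanishes. *)
Lemma sum_from_small_descent f m n :
    cobound P (fun x y => f x y - moved_sum f x y *+ n)%R ->
  sum_from_small m.+1 f -> sum_from_small m f.
Proof.
move=> cf [Om [act [F [[aP cF] F_tors shaF F0 fF]]]].
pose F1 w x y := (F w x y *+ n)%R.
have cF1 : gcocyc P act F1.
  by move=> w x y z Px Py Pz; rewrite -!(mulrnDl, mulrnBl) cF // mul0rn.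
have F1_tors w x y : (F1 w x y *+ p = 0)%R by rewrite mulrnAC F_tors mul0rn.
have shaF1 w : sha (gstab P act w) (F1 w).
  by move=> A sA abA; apply: coboundMn; apply: shaF.
pose act1 := twact rmul kap act.
have aP1 : gact P act1 := gact_twist aU kapP kapM aP.
pose F2 := twist rmul kap F1.
have cF2 : gcocyc P act1 F2 := gcocyc_twist aU kapP kapM cF1.
pose small (uw : {set gT} * Om) := gstab P act uw.2 \subset max_over uw.1.
have smallE uw x : x \in P -> small (act1 uw x) = small uw.
  move=> Px; rewrite /small /= max_over_rmul // (gstab_act _ aP) ?kapP //.
  have nM : kap uw.1 x \in 'N(max_over uw.1).
    by apply: (subsetP (max_over_norm _)); apply: kapP.
  by rewrite -{1}(normP nM) conjSg.
pose Q uw := moved uw.1 && ~~ small uw.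
pose Q2 uw := moved uw.1 && small uw.
have QE uw x : x \in P -> Q (act1 uw x) = Q uw.
  by move=> Px; rewrite /Q smallE //= moved_rmul.
have Q2E uw x : x \in P -> Q2 (act1 uw x) = Q2 uw.
  by move=> Px; rewrite /Q2 smallE //= moved_rmul.
have stabP uw x : x \in gstab P act1 uw ->
    [/\ x \in P, uw.1 :* x = uw.1 & kap uw.1 x \in gstab P act uw.2].
  rewrite !inE => /andP[Px /eqP E]; rewrite kapP //.
  by have := congr1 fst E; have := congr1 snd E => /= -> ->; rewrite eqxx.
exists ({set gT} * Om)%type, act1.
exists (fun uw x y => if Q uw then F2 uw x y else 0)%R; split.
- by split=> //; apply: gcocyc_if.
- by move=> uw x y; case: (Q uw); rewrite ?mul0rn // /F2 /twist F1_tors.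
- move=> uw A sA abA; case: (Q uw); last exact: cobound0.
  apply: (@eq_cobound _ _ _ (fun x y => F1 uw.2 (kap uw.1 x) (kap uw.1 y))).
    by move=> x y /(subsetP sA)/stabP[_ ux _] _; rewrite /F2 /twist /= ux.
  pose B := Group (group_set_gstab uw.2 aP).
  apply: (@sha_pull _ _ A B) (shaF1 _) => //.
    by move=> x /(subsetP sA)/stabP[].
  move=> x y Ax Ay.
  have [Px ux _] := stabP _ _ (subsetP sA x Ax).
  by have [Py _ _] := stabP _ _ (subsetP sA y Ay); rewrite kapM // ux.
- move=> [u w] le_m x y; case: ifP => //= /andP[/= mu /= not_small].
  suff w_big : m.+1 <= #|gstab P act w|.
    by rewrite /F2 /twist /F1 /= F0 ?mul0rn.
  apply: leq_ltn_trans le_m _.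
  have kapI : {in gstab P act1 (u, w) &, injective (kap u)}.
    have /andP[uG _] := mu.
    move=> y1 y2 /stabP[/= _ u1 _] /stabP[/= _ u2 _].
    by rewrite /coset_shift uG u1 u2 => /mulIg/mulgI.
  rewrite -(card_in_imset kapI); apply: proper_card; rewrite properE.
  apply/andP; split.
    by apply/subsetP=> _ /imsetP[z /stabP[_ _ wz] ->].
  apply: contra not_small => /subset_trans; apply.
  apply: subset_trans (max_overP mu).2.
  apply/subsetP=> _ /imsetP[z /stabP[/= Pz uz _] ->].
  by apply: imset_f; rewrite inE Pz uz eqxx.
pose g x y := (f x y - \sum_w F w x y)%R.
have splitE x y : (f x y - \sum_uw (if Q uw then F2 uw x y else 0) =
    (f x y - moved_sum f x y *+ n) + moved_sum g x y *+ n
    + \sum_(uw | Q2 uw) F2 uw x y)%R.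
  have -> : (moved_sum g x y *+ n = moved_sum f x y *+ n
      - \sum_(uw | moved uw.1) F2 uw x y)%R.
    rewrite /moved_sum /g sumrB mulrnBl; congr (_ - _)%R.
    rewrite -sumrMnl (eq_bigl (fun uw => moved uw.1 && predT uw.2)).
      rewrite -(pair_big _ _ (fun u w => F2 (u, w) x y)) /=.
      by apply: eq_bigr => u _; rewrite sumrMnl.
    by move=> uw; rewrite andbT.
  rewrite (bigID small (fun uw => moved uw.1)) /= -/Q -/Q2 -big_mkcond /=.
  rewrite -!/(Q _) -!/(Q2 _); zmodule.
apply: eq_cobound (fun x y _ _ => esym (splitE x y)) _.
apply: coboundD.
  by apply: coboundD => //; apply/coboundMn/cobound_moved_sum.
(* [Psi] collects over [u] the pairs to be discarded; it is trivial on the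
   stabiliser of [u], where [kap u] is a morphism to [max_over u]. *)
pose Psi u x y := (\sum_(uw | Q2 uw && (uw.1 == u)) F2 uw x y)%R.
have cPsi : gcocyc P rmul Psi by apply: (gcocyc_push aP1 aU Q2E _ cF2).
have sPsi u : cobound (gstab P rmul u) (Psi u).
  case mu: (moved u); last first.
    apply: eq_cobound (cobound0 _ _) => x y _ _.
    rewrite /Psi big_pred0 // => uw.
    by rewrite /Q2; case: eqP => [->|]; rewrite ?mu ?andbF.
  have [maxM sDM] := max_overP mu.
  have cM := cobound_sum_stab_sub p_pr pP clP aP cF1 F1_tors shaF1 maxM.
  have uE x : x \in gstab P rmul u -> x \in P /\ u :* x = u.
    by rewrite inE => /andP[Px /eqP].
  have kD x : x \in gstab P rmul u -> kap u x \in max_over u.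
    by move=> ux; apply: (subsetP sDM); apply: imset_f.
  apply: eq_cobound (cobound_pull kD _ cM) => [x y ux uy|x y ux uy].
    rewrite /Psi; rewrite (reindex_onto (fun w => (u, w)) snd) /=.
      apply: eq_big => [w|w _].
        by rewrite /Q2 /= mu !eqxx /= !andbT.
      by rewrite /F2 /twist /= (uE x ux).2.
    by move=> [v w] /= /andP[_ /eqP ->].
  have [[Px uxE] [Py _]] := (uE x ux, uE y uy).
  by rewrite kapM // uxE.
have [c cE] := cobound_push aU (gcobound_stab aU cPsi sPsi).
exists c => x y Px Py; rewrite -cE // /Psi.
by rewrite (partition_big fst predT).
Qed.

End Descent.

(** * Stable classes *)

Section Stable.

Variables (gT : finGroupType) (G P : {group gT}) (p : nat).
Hypotheses (p_pr : prime p) (sylP : p.-Sylow(G) P).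

Let sPG : P \subset G := pHall_sub sylP.
Let pP : p.-group P := pHall_pgroup sylP.

Lemma index_coprime : coprime p #|G : P|.
Proof.
by case/and3P: sylP => _ _; rewrite p'natE // prime_coprime.
Qed.

Lemma cobound_coprime (K : {set gT}) (V : zmodType) (f : gT -> gT -> V) a b :
    coprime a b -> (0 < a)%N -> cobound K (fun x y => f x y *+ a)%R ->
    cobound K (fun x y => f x y *+ b)%R ->
  cobound K f.
Proof.
move=> co_ab a_gt0 fa fb; have [u v uv _] := egcdnP b a_gt0.
rewrite (eqP co_ab) in uv.
apply: eq_cobound (coboundB (coboundMn u fa) (coboundMn v fb)) => x y _ _.
rewrite -!mulrnA [(a * u)%N]mulnC uv [(b * v)%N]mulnC mulrnDr mulr1n.
by rewrite addrC addKr.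
Qed.

Lemma cobound_sylow (f : gT -> gT -> QmodZ) e : cocyc G f -> cobound P f ->
  cobound G (fun x y => f x y *+ p ^ e)%R -> cobound G f.
Proof.
move=> cf fP fe.
have fi : cobound G (fun x y => f x y *+ #|G : P|)%R.
  apply: eq_cobound (coboundB (cor_cobound sPG fP) (cor_res sPG cf)) => x y _ _.
  by rewrite opprB addrC subrK.
apply: cobound_coprime fe fi; last by rewrite expn_gt0 prime_gt0.
by rewrite coprimeXl // index_coprime.
Qed.

(** Modulo [p] the number of fixed cosets is the number of all cosets. *)
Lemma moved_coprime : coprime p #|[set u in rcosets P G | ~~ moved G P u]|.
Proof.
have actsP : [acts P, on rcosets P G | 'Rs].
  apply/actsP=> x Px u; rewrite /= rcosetE.
  by rewrite rcosets_rmul // (subsetP sPG).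
have -> : [set u in rcosets P G | ~~ moved G P u] = 'Fix_(rcosets P G | 'Rs)(P).
  apply/setP=> u; rewrite in_setI in_set /moved.
  case uG: (u \in rcosets P G) => //=.
  apply/exists_inPn/afixP => ux x Px.
    by have := ux x Px; rewrite negbK /= rcosetE => /eqP.
  by rewrite negbK -rcosetE; apply/eqP/ux.
rewrite prime_coprime // /dvdn -(pgroup_fix_mod pP actsP) -/(dvdn _ _).
rewrite -prime_coprime //; exact: index_coprime.
Qed.

Variable al : gT -> gT -> QmodZ.
Hypotheses (clP : nil_class P <= p) (cal : cocyc P al) (shal : sha P al).
Hypothesis al_inv : forall n, n \in 'N_G(P) ->
  cobound P (fun x y => al (x ^ n)%g (y ^ n)%g - al x y)%R.

(** Mackey's formula: at a fixed coset [kap] is the conjugation by an element of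
[N_G(P)], under which the class of [al] is invariant. *)
Lemma cor_moved_sum :
  cobound P (fun x y => cor G P al x y -
    (al x y *+ #|[set u in rcosets P G | ~~ moved G P u]|
     + moved_sum G P al x y))%R.
Proof.
pose fx u := (u \in rcosets P G) && ~~ moved G P u.
have fxP u : fx u -> [/\ (repr u)^-1 \in 'N_G(P) &
    forall x, x \in P -> u :* x = u /\ coset_shift G P u x = x ^ (repr u)^-1].
  case/andP=> uG; rewrite /moved uG /= => /exists_inPn ux.
  have [uE Gu] := repr_rcosets sPG uG.
  have {}ux x : x \in P -> u :* x = u by move=> /ux; rewrite negbK => /eqP.
  have kE x : x \in P -> coset_shift G P u x = x ^ (repr u)^-1.
    by move=> Px; rewrite /coset_shift uG ux // conjgE invgK mulgA.
  split=> [|x Px]; last by rewrite ux // kE.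
  apply/setIP; split; first by rewrite groupV.
  rewrite inE; apply/subsetP=> _ /imsetP[x Px ->].
  by rewrite -kE //; apply: (coset_shift_in sPG); apply: (subsetP sPG).
have c u : fx u -> cobound P (fun x y =>
    al (coset_shift G P u x) (coset_shift G P (u :* x) y) - al x y)%R.
  move=> /fxP[Nu uP]; apply: eq_cobound (al_inv Nu) => x y Px Py.
  by have [[-> ->] [_ ->]] := (uP x Px, uP y Py).
apply: eq_cobound (cobound_sum c) => x y Px Py.
have -> : (cor G P al x y = moved_sum G P al x y + \sum_(u | fx u)
    al (coset_shift G P u x) (coset_shift G P (u :* x) y))%R.
  rewrite /cor (bigID (moved G P)) /=; congr (_ + _)%R.
  by apply: eq_bigl => u; rewrite andb_idl // => /andP[].
rewrite sumrB sumr_const.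
have -> : #|fx| = #|[set u in rcosets P G | ~~ moved G P u]|.
  by apply: eq_card => u; rewrite inE.
zmodule.
Qed.

(** The fixed cosets contribute [al *+ N] with [N] prime to [p], so that the
vanishing of the corestriction expresses [al] through [moved_sum al], and the
descent applies down to the empty sum. *)
Lemma cobound_of_cor :
    cobound P (fun x y => al x y *+ p)%R -> cobound P (cor G P al) ->
  cobound P al.
Proof.
move=> al_p al_cor.
set N := #|[set u in rcosets P G | ~~ moved G P u]|.
have p_gt0 := prime_gt0 p_pr.
have [n _ /dvdnP[k nE]] := Bezoutl N p_gt0.
rewrite (eqP moved_coprime) in nE.
have fix_al : cobound P (fun x y => al x y - moved_sum G P al x y *+ n)%R.
  have c := coboundMn n (coboundB cor_moved_sum al_cor).
  apply: eq_cobound (coboundD c (coboundMn k al_p)) => x y _ _.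
  rewrite -[in X in (_ + X)%R]mulrnA [(p * k)%N]mulnC -nE mulrnDr mulr1n.
  have -> : (cor G P al x y - (al x y *+ N + moved_sum G P al x y)
    - cor G P al x y = - (al x y *+ N) - moved_sum G P al x y)%R by zmodule.
  rewrite mulrnBl mulNrn -mulrnA [(N * n)%N]mulnC; zmodule.
have [c cE] := al_p.
have /choice[d dE] : forall q : QmodZ, exists r, (r *+ p = q)%R.
  by move=> q; have [r /eqP rE] := QmodZ_divisible q p_gt0; exists r.
(* A representative of the class of [al] with values in the [p]-torsion. *)
pose b x y := (if (x \in P) && (y \in P) then
  al x y - (d (c y) - d (c (x * y)%g) + d (c x)) else 0)%R.
have bE : cobound P (fun x y => al x y - b x y)%R.
  exists (fun x => d (c x)) => x y Px Py; rewrite /b Px Py /=; zmodule.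
have small : sum_from_small P p #|P|.+1 al.
  exists unit, (fun w _ => w), (fun _ => b); split.
  - split; first exact: gact_unit.
    apply/cocyc_gcocyc; have [g gE] := bE.
    move=> x y z Px Py Pz.
    have alE u v : u \in P -> v \in P ->
        b u v = (al u v - (g v - g (u * v)%g + g u))%R.
      by move=> Pu Pv; rewrite -gE // opprB addrC subrK.
    rewrite !alE ?groupM // mulgA; have := cal Px Py Pz => X0.
    by apply: (eq_lin3 X0 (erefl 0%R) (erefl 0%R)); zmodule.
  - move=> _ x y; rewrite /b.
    case: ifP => [/andP[Px Py]|_]; last by rewrite mul0rn.
    by rewrite mulrnBl mulrnDl mulrnBl !dE cE // subrr.
  - move=> w; apply: (@shaS _ _ P).
      by apply/subsetP=> x; rewrite inE => /andP[].
    apply: eq_sha (shaB shal (sha_cobound bE)) => x y _ _.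
    by rewrite opprB addrC subrK.
  - move=> w; rewrite ltnNge subset_leq_card //.
    by apply/subsetP=> x; rewrite inE => /andP[].
  - apply: eq_cobound bE => x y _ _; congr (_ - _)%R.
    by rewrite (big_pred1 tt) //; case.
elim: #|P|.+1 small => [|m IHm] sm; first exact: sum_from_small0 sm.
exact/IHm/(sum_from_small_descent sPG p_pr pP clP fix_al).
Qed.

End Stable.

(** * Cohomology classes *)

Section Classes.

Variable gT : finGroupType.
Implicit Types (K : {group gT}) (f g : gT -> gT -> QmodZ).
Local Open Scope quotient_scope.

Definition lift K (x : H2 (subg_of K)) : gT -> gT -> QmodZ :=
  fun a b => val (generic_quotient.repr x) (subg K a, subg K b).

(** The default value [0] is taken when [f] is not a cocycle on [K]. *)
Definition cls K f : H2 (subg_of K) :=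
  \pi_(H2 (subg_of K)) (insubd (0%R : cocycle2 (subg_of K))
    [ffun z => f (sgval z.1) (sgval z.2)]).

Lemma cls_val K f : cocyc K f ->
  val (insubd (0%R : cocycle2 (subg_of K))
         [ffun z => f (sgval z.1) (sgval z.2)])
    = [ffun z => f (sgval z.1) (sgval z.2)].
Proof.
move=> cf; rewrite insubdK // unfold_in; apply/eqP/ffunP=> -[[x y] z].
by rewrite !ffunE /=; apply: cf; apply: subgP.
Qed.

Lemma eq_clsP K f g : cocyc K f -> cocyc K g ->
  cls K f = cls K g <-> cobound K (fun x y => f x y - g x y)%R.
Proof.
move=> cf cg; rewrite /cls; split=> [/eq_pi_H2[c]|[c cE]].
  rewrite !cls_val // => /ffunP cE; exists (fun x => c (subg K x)) => x y Kx Ky.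
  have := cE (subg K x, subg K y); rewrite !ffunE /= !subgK //.
  by rewrite subgM.
apply/eq_pi_H2; exists [ffun x => c (sgval x)]; rewrite !cls_val //.
by apply/ffunP=> -[x y]; rewrite !ffunE /= cE ?subgP.
Qed.

Lemma cocyc_lift K (x : H2 (subg_of K)) : cocyc K (lift x).
Proof.
move=> a b c Ka Kb Kc; rewrite /lift !subgM //.
have /eqP/ffunP/(_ (subg K a, subg K b, subg K c)) :=
  valP (generic_quotient.repr x).
by rewrite !ffunE.
Qed.

Lemma liftK K (x : H2 (subg_of K)) : cls K (lift x) = x.
Proof.
rewrite -[RHS]reprK /cls; congr (\pi_(H2 (subg_of K)) _); apply: val_inj.
rewrite cls_val; last exact: cocyc_lift.
by apply/ffunP=> -[a b]; rewrite !ffunE /lift /= !sgvalK.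
Qed.

Lemma cls_liftP K f : cocyc K f ->
  cobound K (fun x y => lift (cls K f) x y - f x y)%R.
Proof.
by move=> cf; apply/eq_clsP => //; rewrite ?liftK //; apply: cocyc_lift.
Qed.

Lemma cocycD (K : {set gT}) f g :
  cocyc K f -> cocyc K g -> cocyc K (fun x y => f x y + g x y)%R.
Proof.
move=> cf cg x y z Kx Ky Kz; rewrite -[RHS]addr0.
rewrite -[in X in _ = (X + _)%R](cf x y z) //.
rewrite -[in X in _ = (_ + X)%R](cg x y z) //; zmodule.
Qed.

Lemma clsD K f g : cocyc K f -> cocyc K g ->
  cls K (fun x y => f x y + g x y)%R = (cls K f + cls K g)%R.
Proof.
move=> cf cg; rewrite /cls -raddfD; congr (\pi_(H2 (subg_of K)) _).
apply: val_inj; rewrite raddfD /= (cls_val cf) (cls_val cg).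
rewrite (cls_val (cocycD cf cg)).
by apply/ffunP=> z; rewrite !ffunE.
Qed.

Lemma cocyc0 (K : {set gT}) : cocyc K (fun _ _ => 0%R : QmodZ).
Proof. by move=> x y z _ _ _; rewrite !subr0 addr0. Qed.

Lemma cls0 K : cls K (fun _ _ => 0%R) = 0%R.
Proof.
rewrite -[RHS](raddf0 (\pi_(H2 (subg_of K)) : cocycle2 _ -> H2 _)).
congr (\pi_(H2 (subg_of K)) _).
apply: val_inj; rewrite (cls_val (@cocyc0 K)) raddf0.
by apply/ffunP=> z; rewrite !ffunE.
Qed.

Lemma cocycMn (K : {set gT}) f n :
  cocyc K f -> cocyc K (fun x y => f x y *+ n)%R.
Proof.
by move=> cf x y z Kx Ky Kz; rewrite -!(mulrnDl, mulrnBl) cf // mul0rn.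
Qed.

Lemma clsMn K f n : cocyc K f ->
  cls K (fun x y => f x y *+ n)%R = (cls K f *+ n)%R.
Proof.
move=> cf; elim: n => [|n IHn].
  by rewrite mulr0n -(cls0 K); congr cls.
rewrite mulrS -IHn -clsD //; last exact: cocycMn.
by congr cls; apply/funext=> x; apply/funext=> y; rewrite mulrS.
Qed.

Lemma cls_eq0 K f : cocyc K f -> cls K f = 0%R <-> cobound K f.
Proof.
move=> cf; rewrite -(cls0 K) eq_clsP //; last exact: cocyc0.
by split; apply: eq_cobound => x y _ _; rewrite subr0.
Qed.

Lemma H2_expgE K (x : H2 (subg_of K)) n : x ^+ n = (x *+ n)%R.
Proof. by elim: n => // n IHn; rewrite expgS IHn mulrS. Qed.

Lemma res_H2_cls_eq0 K (A : {group subg_of K}) f : cocyc K f ->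
  res_H2 A (cls K f) = 0%R <-> cobound (sgval @* A) f.
Proof.
move=> cf; rewrite /cls res_H2_pi.
rewrite -(raddf0 (\pi_(H2 (subg_of A)) : cocycle2 _ -> H2 _)) eq_pi_H2.
split=> -[c cE].
  exists (fun a => c (subg A (subg K a))).
  move=> _ _ /morphimP[x _ Ax ->] /morphimP[y _ Ay ->].
  have /ffunP/(_ (subg A x, subg A y)) := cE.
  rewrite raddf0 !ffunE /= cls_val // ffunE /= !subgK //.
  rewrite addr0 -[(sgval x * sgval y)%g]/(sgval (x * y)) !sgvalK => ->.
  by rewrite subgM.
exists [ffun a => c (sgval (sgval a))]; apply/ffunP=> -[x y].
rewrite raddf0 !ffunE /= cls_val // ffunE /= addr0.
have Am (u : [subg A]) : sgval (sgval u) \in sgval @* A.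
  by apply: mem_morphim; rewrite ?inE ?subgP.
by rewrite cE.
Qed.

Lemma cls_sha K f : cocyc K f -> (cls K f \in Sha2 (subg_of K)) <-> sha K f.
Proof.
move=> cf; split=> [/Sha2P s A sAK abA|s].
  have := s (subg K @* A)%G (morphim_abelian _ abA).
  by move/(res_H2_cls_eq0 _ cf); rewrite /= subgmK.
apply/Sha2P=> A abA; apply/res_H2_cls_eq0 => //.
apply: (s (sgval @* A)%G); last exact: morphim_abelian.
by apply/subsetP=> _ /morphimP[x _ _ ->]; apply: subgP.
Qed.

End Classes.

(** * Local control *)

Section LocalControl.

Variable gT : finGroupType.
Implicit Types (K L : {group gT}).

(** The operations on cochains that induce a morphism in cohomology; the
instances are restriction and corestriction. *)
Definition cochain_op K L (t : (gT -> gT -> QmodZ) -> gT -> gT -> QmodZ) :=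
  [/\ forall f, cocyc K f -> cocyc L (t f),
      forall f, cobound K f -> cobound L (t f)
    & forall f g x y,
        t (fun x y => f x y - g x y)%R x y = (t f x y - t g x y)%R].

Definition H2_map K L t (x : H2 (subg_of K)) : H2 (subg_of L) :=
  cls L (t (lift x)).
Arguments H2_map : clear implicits.

Lemma cocycB (K : {set gT}) (f g : gT -> gT -> QmodZ) :
  cocyc K f -> cocyc K g -> cocyc K (fun x y => f x y - g x y)%R.
Proof.
move=> cf cg x y z Kx Ky Kz; rewrite -[RHS]subr0.
rewrite -[in X in _ = (X - _)%R](cf x y z) //.
rewrite -[in X in _ = (_ - X)%R](cg x y z) //; zmodule.
Qed.

Lemma clsB K f g : cocyc K f -> cocyc K g ->
  cls K (fun x y => f x y - g x y)%R = (cls K f - cls K g)%R.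
Proof.
move=> cf cg; apply/eqP; rewrite -subr_eq0 opprB addrA subr_eq0; apply/eqP.
rewrite -clsD //; last exact: cocycB.
by congr cls; apply/funext=> x; apply/funext=> y; rewrite subrK.
Qed.

Section Map.

Variables (K L : {group gT}) (t : (gT -> gT -> QmodZ) -> gT -> gT -> QmodZ).
Hypothesis tP : cochain_op K L t.

Lemma H2_map_cls f : cocyc K f -> H2_map K L t (cls K f) = cls L (t f).
Proof.
case: tP => tc tb tB cf.
apply/eq_clsP; [exact/tc/cocyc_lift | exact: tc |].
by apply: eq_cobound (tb _ (cls_liftP cf)) => x y _ _; rewrite tB.
Qed.

Lemma H2_mapB x y :
  H2_map K L t (x - y)%R = (H2_map K L t x - H2_map K L t y)%R.
Proof.
have [cx cy] := (cocyc_lift x, cocyc_lift y); have [tc _ tB] := tP.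
rewrite -{1}(liftK x) -{1}(liftK y) -clsB // H2_map_cls; last exact: cocycB.
rewrite -clsB; [|exact: tc|exact: tc].
by congr cls; apply/funext=> a; apply/funext=> b; rewrite tB.
Qed.

Lemma H2_mapM (D : {set H2 (subg_of K)}) :
  {in D &, {morph H2_map K L t : x y / x * y}}.
Proof.
move=> x y _ _; rewrite !FinRing.zmodMgE.
by rewrite -{2}[x](addrK y) H2_mapB subrK.
Qed.

End Map.

Lemma cochain_op_res K L : L \subset K -> cochain_op K L id.
Proof. by move=> sLK; split=> // f; [apply: cocycS | apply: coboundS]. Qed.

Lemma cochain_op_cor K L : L \subset K -> cochain_op L K (cor K L).
Proof.
move=> sLK; split=> [f|f|f g x y]; first exact: cor_cocyc.
  exact: cor_cobound.
exact: corB.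
Qed.

Section Stable.

Variables G P : {group gT}.

(** Invariance is asked under [N_G(P)] only, so that [G] and [N_G(P)] define the
same classes. *)
Definition stable_sha : {set H2 (subg_of P)} :=
  [set x | `[< sha P (lift x) /\ forall n, n \in 'N_G(P) ->
     cobound P (fun a b => lift x (a ^ n)%g (b ^ n)%g - lift x a b)%R >]].

Lemma stable_shaP f : cocyc P f ->
  reflect (sha P f /\ forall n, n \in 'N_G(P) ->
     cobound P (fun a b => f (a ^ n)%g (b ^ n)%g - f a b)%R)
    (cls P f \in stable_sha).
Proof.
move=> cf; rewrite inE; have d := cls_liftP cf.
have dn n : n \in 'N_G(P) -> cobound P (fun a b =>
    lift (cls P f) (a ^ n)%g (b ^ n)%g - f (a ^ n)%g (b ^ n)%g)%R.
  case/setIP=> _ nPn; apply: (cobound_pull (h := fun a => a ^ n) _ _ d).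
    by move=> x Px; rewrite memJ_norm.
  by move=> x y _ _; rewrite conjMg.
apply: (iffP (asboolP _)) => -[s inv]; split.
- apply: eq_sha (shaB s (sha_cobound d)) => x y _ _; zmodule.
- move=> n Nn; apply: eq_cobound (coboundD (coboundB (inv n Nn) (dn n Nn)) d).
  by move=> x y _ _; zmodule.
- apply: eq_sha (shaB s (sha_cobound (coboundN d))) => x y _ _; zmodule.
- move=> n Nn; apply: eq_cobound (coboundB (coboundD (inv n Nn) (dn n Nn)) d).
  by move=> x y _ _; zmodule.
Qed.

Lemma stable_sha_group_set : group_set stable_sha.
Proof.
apply/group_setP; split.
  rewrite -[1](cls0 P); apply/stable_shaP; first exact: cocyc0.
  split=> [|n _]; first exact/sha_cobound/cobound0.
  by apply: eq_cobound (cobound0 _ _) => x y _ _; rewrite subr0.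
move=> x y; rewrite -(liftK x) -(liftK y).
have [cx cy] := (cocyc_lift x, cocyc_lift y).
move=> /(stable_shaP cx)[sx ix] /(stable_shaP cy)[sy iy].
rewrite FinRing.zmodMgE -clsD //; apply/stable_shaP; first exact: cocycD.
split=> [A sA abA|n Nn]; first by apply: coboundD; [apply: sx|apply: sy].
apply: eq_cobound (coboundD (ix n Nn) (iy n Nn)) => a b _ _; zmodule.
Qed.

Definition stable_group := Group stable_sha_group_set.

End Stable.

(** Restriction to the trivial group followed by corestriction is the
multiplication by the order. *)
Lemma cobound_card K (f : gT -> gT -> QmodZ) :
  cocyc K f -> cobound K (fun x y => f x y *+ #|K|)%R.
Proof.
move=> cf; have f1 : cobound (1%G : {group gT}) f.
  by exists (fun=> f 1 1) => x y /set1P-> /set1P->; rewrite subrr add0r.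
have s1 := sub1G K.
apply: eq_cobound (coboundB (cor_cobound s1 f1) (cor_res s1 cf)) => x y _ _.
by rewrite opprB addrC subrK indexg1.
Qed.

Lemma H2_p_elt K p (x : H2 (subg_of K)) n :
  p.-nat n -> (x *+ n = 0)%R -> p.-elt x.
Proof.
move=> pn xn; apply: pnat_dvd pn; rewrite order_dvdn H2_expgE.
exact/eqP.
Qed.

Section Control.

Variables (G P : {group gT}) (p : nat).
Hypotheses (p_pr : prime p) (sylP : p.-Sylow(G) P) (clP : nil_class P <= p).

Let sPG : P \subset G := pHall_sub sylP.
Let pP : p.-group P := pHall_pgroup sylP.
Local Notation rho := (H2_map G P id).
Local Notation theta := (H2_map P G (cor G P)).

Let rhoP : cochain_op G P id := cochain_op_res sPG.
Let thetaP : cochain_op P G (cor G P) := cochain_op_cor sPG.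

Let rho_cls f : cocyc G f -> rho (cls G f) = cls P f.
Proof. by move=> cf; rewrite (H2_map_cls rhoP cf). Qed.

Let theta_cls f : cocyc P f -> theta (cls P f) = cls G (cor G P f).
Proof. by move=> cf; rewrite (H2_map_cls thetaP cf). Qed.

Lemma H2_sylow_p_elt (y : H2 (subg_of P)) : p.-elt y.
Proof.
apply: (@H2_p_elt _ _ _ #|P|); first exact: pP.
rewrite -(liftK y) -clsMn; last exact: cocyc_lift.
apply/cls_eq0; first exact/cocycMn/cocyc_lift.
exact/cobound_card/cocyc_lift.
Qed.

Lemma res_stable x : x \in Sha2 (subg_of G) -> rho x \in stable_sha G P.
Proof.
rewrite -(liftK x); have cx := cocyc_lift x.
move=> /(cls_sha cx) sx; rewrite rho_cls //.
apply/stable_shaP; first exact: cocycS cx.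
split=> [|n /setIP[Gn _]]; first exact: shaS sx.
exact: coboundS sPG (cobound_conj cx Gn).
Qed.

Lemma res_eq0 x : p.-elt x -> rho x = 0%R -> x = 0%R.
Proof.
move=> /p_natP[e xe]; rewrite -(liftK x); have cx := cocyc_lift x.
rewrite rho_cls // cls_eq0 => [xP|]; last exact: cocycS cx.
apply/cls_eq0 => //; apply: (cobound_sylow p_pr sylP (e := e)) => //.
apply/cls_eq0; first exact: cocycMn.
by rewrite clsMn // liftK -H2_expgE -xe expg_order.
Qed.

Lemma cor_stable_sha y : y \in stable_sha G P ->
  theta y \in Sha2 (subg_of G) /\ p.-elt (theta y).
Proof.
rewrite -(liftK y); have cy := cocyc_lift y.
move=> /(stable_shaP _ cy)[sy _]; rewrite theta_cls //; split.
  by apply/cls_sha; [apply: cor_cocyc | apply: cor_sha].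
apply: (@H2_p_elt _ _ _ #|P|); first exact: pP.
rewrite -clsMn; last exact: cor_cocyc.
apply/cls_eq0; first exact/cocycMn/cor_cocyc.
have := cor_cobound sPG (cobound_card cy).
by apply: eq_cobound => x z _ _; rewrite /cor sumrMnl.
Qed.

(** The endomorphism [rho \o theta] of the finite group of stable classes is
injective, as its kernel has no element of order [p]; so it is onto. *)
Lemma res_cor_surj y : y \in stable_sha G P ->
  exists2 z, z \in stable_sha G P & y = rho (theta z).
Proof.
pose I := stable_group G P.
have phiM : {in I &, {morph (fun z => rho (theta z)) : x y / x * y}}.
  move=> x z Ix Iz.
  rewrite (H2_mapM thetaP Ix Iz) //.
  exact: (H2_mapM rhoP (in_setT _) (in_setT _)).
pose phi := Morphism phiM.
have phiI z : z \in I -> phi z \in I.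
  by move=> /cor_stable_sha[sz _]; apply: res_stable.
have inj : 'injm phi.
  apply/subsetP=> z0 z0K; apply/set1P.
  have Iz0 : z0 \in I := dom_ker z0K.
  apply: contraTeq isT => nz0.
  have [[|e] z0E] := p_natP (H2_sylow_p_elt z0).
    by rewrite -order_eq1 z0E eqxx in nz0.
  pose w := z0 ^+ (p ^ e).
  have wK : w \in 'ker phi by apply: groupX.
  have wp : (w *+ p = 0)%R.
    by rewrite -H2_expgE -expgM -expnSr -z0E expg_order.
  have nw : w != 1.
    rewrite -order_dvdn z0E; apply/negP=> /dvdn_leq.
    rewrite expn_gt0 prime_gt0 //.
    by move=> /(_ isT); rewrite leq_exp2l ?prime_gt1 // ltnn.
  have cw := cocyc_lift w.
  have [sw iw] : sha P (lift w) /\ forall n, n \in 'N_G(P) ->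
      cobound P (fun a b => lift w (a ^ n)%g (b ^ n)%g - lift w a b)%R.
    by apply/(stable_shaP _ cw); rewrite liftK; apply: dom_ker wK.
  have w0 : w = 0%R.
    rewrite -(liftK w); apply/cls_eq0 => //.
    apply: (cobound_of_cor p_pr sylP clP cw sw iw).
      by apply/cls_eq0; [apply: cocycMn | rewrite clsMn // liftK].
    apply/cls_eq0; first exact: cocycS (cor_cocyc sPG cw).
    rewrite -rho_cls; last exact: cor_cocyc.
    by rewrite -theta_cls // liftK; apply: (mker wK).
  by rewrite w0 eqxx in nw.
have imI : phi @* I = I.
  apply/eqP; rewrite eqEcard card_injm // leqnn andbT.
  by apply/subsetP=> _ /morphimP[z _ Iz ->]; apply: phiI.
rewrite -[stable_sha G P]/(I : {set _}) -{1}imI => /morphimP[z _ Iz ->].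
by exists z.
Qed.

(** The [p]-elements of the multiplier form [S], which is normal because the
multiplier is abelian, and restriction identifies them with the stable
classes. *)
Lemma sylow_bogomolov_isog (S : {group H2 (subg_of G)}) :
  p.-Sylow(bogomolov_multiplier G) S -> S \isog stable_group G P.
Proof.
move=> sylS; have sSG : S \subset bogomolov_multiplier G := pHall_sub sylS.
have nsS : S <| bogomolov_multiplier G.
  by rewrite -sub_abelian_normal // FinRing.zmod_abelian.
have SP x : (x \in S) = (x \in Sha2 (subg_of G)) && p.-elt x.
  apply/idP/andP=> [Sx|[sx px]]; last by rewrite (mem_normal_Hall sylS).
  split; first exact: (subsetP sSG).
  exact: mem_p_elt (pHall_pgroup sylS) Sx.
pose r := Morphism (H2_mapM rhoP (D := S)).
apply/isogP; exists r.
  apply/subsetP=> x xK; apply/set1P; apply: res_eq0; last exact: mker xK.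
  by have := dom_ker xK; rewrite SP => /andP[].
apply/setP=> y; apply/morphimP/idP=> [[x _ Sx ->]|].
  by apply: res_stable; rewrite SP in Sx; case/andP: Sx.
case/res_cor_surj=> z Iz ->; have [sz pz] := cor_stable_sha Iz.
by exists (theta z); rewrite ?SP ?sz.
Qed.

End Control.

End LocalControl.

Theorem theorem1p1 (gT : finGroupType) (G P : {group gT}) (p : nat)
    (p_pr : prime p) (sylP : p.-Sylow(G) P) (clP : (nil_class P <= p)%N)
    (S : {group H2 (subg_of G)}) (T : {group H2 (subg_of 'N_G(P))}) :
    p.-Sylow(bogomolov_multiplier G) S ->
    p.-Sylow(bogomolov_multiplier 'N_G(P)) T ->
  S \isog T.
Proof.
move=> sylS sylT.
have sylPN : p.-Sylow('N_G(P)) P.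
  apply: (pHall_subl _ _ sylP); last exact: subsetIl.
  by rewrite subsetI (pHall_sub sylP) normG.
have isoS := sylow_bogomolov_isog p_pr sylP clP sylS.
have isoT := sylow_bogomolov_isog p_pr sylPN clP sylT.
apply: isog_trans isoS _; rewrite isog_sym.
suff stableE : stable_sha 'N_G(P) P = stable_sha G P.
  by rewrite /= stableE in isoT.
by rewrite /stable_sha /= -setIA setIid.
Qed.
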